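(* Let $\mathcal{G}$ be the generic structure for the class of all finite flat pregeometries with respect to $\sqsubseteq$. Let $\tau:\mathbb{N}\to\mathbb{N}$ with $\tau(n)\ge n$ for all $n$ be such that $T:=T_\tau$ is satisfiable. Then $T\equiv \mathrm{Th}(\mathcal{G})$, i.e. $T_\tau$ axiomatizes the complete $\mathcal{L}$-theory of $\mathcal{G}$. In particular, $T=T_\tau$ is a complete theory independent of the specific choice of $\tau$.
   Context: Pregeometries. A pregeometry $G$ on a (possibly infinite) set $M$ is a function $d=d_G$ from the finite subsets of $M$ to $\mathbb{N}$ such that $d(\emptyset)=0$, $d(A)\le d(A\cup\{x\})\le d(A)+1$, and $d(A\cup B)+d(A\cap B)\le d(A)+d(B)$. A finite $A$ is independent if $d(A)=|A|$; an arbitrary set is independent if all its finite subsets are; $d(Y)=\sup\{|Y_0|: Y_0\subseteq Y \text{ independent}\}$. For finite $A$, $\mathrm{cl}_G(A)=\{x: d(A\cup\{x\})=d(A)\}$, and $\mathrm{cl}_G(Y)=\bigcup\{\mathrm{cl}_G(Y_0): Y_0\subseteq Y\text{ finite}\}$. $Y$ is closed in $G$ if $\mathrm{cl}_G(Y)=Y$. A subpregeometry $H\subseteq G$ is the restriction of $d_G$ to subsets of a subset; subsets and subpregeometries are identified. For a finite collection $\Sigma=\{E_1,\dots,E_k\}$ of finite-dimensional closed sets of $G$ let $\Delta_G(\Sigma)=\sum_{\emptyset\ne s\subseteq\{1,\dots,k\}}(-1)^{|s|+1}d_G\left(\bigcap_{i\in s}E_i\right)$. $G$ is flat if $\Delta_G(\Sigma)\ge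 d_G(\bigcup\Sigma)$ for every such $\Sigma$. Embeddings. For $H\subseteq G$: $H\sqsubseteq^* G$ means $d_H(X_1\cap X_2)=d_G(\mathrm{cl}_G(X_1)\cap\mathrm{cl}_G(X_2))$ for all $X_1,X_2$ closed in $H$. $H\sqsubseteq G$ means that for every finite collection $\Sigma$ of finite-dimensional closed sets of $G$, $\Delta_H(\{E\cap H: E\in\Sigma\})\le\Delta_G(\Sigma)$. $X\sqsubseteq^n G$ means: $X\sqsubseteq^* G$ and $X\sqsubseteq Y$ for every $Y$ with $X\subseteq Y\sqsubseteq^* G$ and $|Y\setminus X|\le n$. Language and theory. Pregeometries are structures in the language $\mathcal{L}=\{I_n:n\in\omega\}$, $I_n$ an $n$-ary relation symbol interpreted as the set of independent $n$-tuples. $\mathfrak{C}$ is the class of all finite flat pregeometries. For $\tau:\mathbb{N}\to\mathbb{N}$ with $\tau(n)\ge n$, $T_\tau$ is the $\mathcal{L}$-theory stating of the ambient structure $G$: (T1) $G$ is a flat pregeometry; (T2) $G$ is infinite-dimensional; (T3) for all finite $F\sqsubseteq^* G$, all $H\in\mathfrak{C}$ with $F\sqsubseteq H$, and all $n\in\mathbb{N}$: if $F\sqsubseteq^{\tau(|H|+n)}G$ then there is an embedding $f:H\to G$ fixing $F$ pointwise with $f[H]\sqsubseteq^n G$. Generic structure. $\mathcal{G}$ is the countable pregeometry, unique up to isomorphism, such that: (i) up to isomorphism, the finite $A\sqsubseteq\mathcal{G}$ are exactly the members of $\mathfrak{C}$; (ii) whenever $A\sqsubseteq\mathcal{G}$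 is finite and $A\sqsubseteq B\in\mathfrak{C}$, there is an embedding $f:B\to\mathcal{G}$ fixing $A$ pointwise with $f[B]\sqsubseteq\mathcal{G}$; (iii) every finite subset of $\mathcal{G}$ is contained in a finite $A\sqsubseteq\mathcal{G}$. *)

(* Defs.v *)
From HB Require Import structures.
From mathcomp Require Import all_boot all_order all_algebra finmap.
From mathcomp Require Import boolp classical_sets functions cardinality.

Set Implicit Arguments.
Unset Strict Implicit.
Unset Printing Implicit Defensive.

Import Order.TTheory GRing.Theory Num.Theory.

Local Open Scope classical_set_scope.

Record pregeometry (M : choiceType) := Pregeometry {
  rk : {fset M} -> nat;
  rk0 : rk fset0 = 0%N;
  rk_incr : forall (A : {fset M}) (x : M),
    (rk A <= rk (A `|` [fset x])%fset)%N /\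
    (rk (A `|` [fset x])%fset <= (rk A).+1)%N;
  rk_submod : forall A B : {fset M},
    (rk (A `|` B)%fset + rk (A `&` B)%fset <= rk A + rk B)%N
}.

Section Pregeometry.
Context (M : choiceType) (G : pregeometry M).

Definition indep (A : {fset M}) : Prop := rk G A = #|` A|.

(* Sizes of the finite independent subsets of [Y]; since a set is independent
   iff all its finite subsets are, these have the same supremum in
   [nat + {oo}] as the sizes of arbitrary independent subsets. *)
Definition indep_sizes (Y : set M) : set nat :=
  [set n | exists A : {fset M}, [/\ indep A, [set` A] `<=` Y & n = #|` A|]].

Definition fin_dim (Y : set M) : Prop :=
  exists n, forall m, indep_sizes Y m -> (m <= n)%N.

(* The dimension of an arbitrary set, [None] standing for infinity. *)
Definition edim (Y : set M) : option nat :=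
  if `[< fin_dim Y >] then Some (supremum 0%N (indep_sizes Y)) else None.

(* Only meaningful on finite-dimensional sets. *)
Definition dim (Y : set M) : nat := odflt 0%N (edim Y).

Definition clf (A : {fset M}) : set M :=
  [set x | rk G (A `|` [fset x])%fset = rk G A].

Definition cl (Y : set M) : set M :=
  [set x | exists A : {fset M}, [set` A] `<=` Y /\ clf A x].

Definition is_closed (Y : set M) : Prop := cl Y = Y.

(* Repetitions among the [E i] are allowed; they do not change the value of
   the alternating sum. *)
Definition Delta (k : nat) (E : 'I_k -> set M) : int :=
  (\sum_(s : {set 'I_k} | (0 < #|s|)%N)
     (-1) ^+ (#|s|.+1) * (dim (\bigcap_(i in [set j | j \in s]) E i))%:Z)%R.

Definition fd_closed (k : nat) (E : 'I_k -> set M) : Prop :=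
  forall i, is_closed (E i) /\ fin_dim (E i).

Definition flat : Prop :=
  forall (k : nat) (E : 'I_k -> set M), fd_closed E ->
    ((dim (\bigcup_i E i))%:Z <= Delta E)%R.

End Pregeometry.

Section Restriction.
Context (M : choiceType) (G : pregeometry M) (X : set M).

Definition sub_rk (A : {fset X}) : nat := rk G [fset val x | x in A]%fset.

Lemma sub_rk0 : sub_rk fset0 = 0%N.
Proof. by rewrite /sub_rk imfset0 rk0. Qed.

Lemma sub_rk_incr (A : {fset X}) (x : X) :
  (sub_rk A <= sub_rk (A `|` [fset x])%fset)%N /\
  (sub_rk (A `|` [fset x])%fset <= (sub_rk A).+1)%N.
Proof. by rewrite /sub_rk imfsetU imfset_fset1; exact: rk_incr. Qed.

Lemma sub_rk_submod (A B : {fset X}) :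
  (sub_rk (A `|` B)%fset + sub_rk (A `&` B)%fset <= sub_rk A + sub_rk B)%N.
Proof.
rewrite /sub_rk imfsetU imfsetI; first exact: rk_submod.
by move=> x y _ _; exact: val_inj.
Qed.

Definition restrict : pregeometry X :=
  Pregeometry sub_rk0 sub_rk_incr sub_rk_submod.

End Restriction.

Definition embedding (M N : choiceType) (G : pregeometry M)
    (H : pregeometry N) (f : M -> N) : Prop :=
  injective f /\ forall A : {fset M}, rk H [fset f x | x in A]%fset = rk G A.

Section Strong.
Context (M : choiceType) (G : pregeometry M).

(* [strong_star], [strong] and [nstrong n] are the relations "square-subset
   with superscript star", "square-subset" and "square-subset with superscript
   n" between a subset [X] of [G] and [G]. *)
Definition strong_star (X : set M) : Prop :=
  forall X1 X2 : set X,
    is_closed (restrict G X) X1 -> is_closed (restrict G X) X2 ->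
    edim (restrict G X) (X1 `&` X2) =
    edim G (cl G (val @` X1) `&` cl G (val @` X2)).

Definition strong (X : set M) : Prop :=
  forall (k : nat) (E : 'I_k -> set M), fd_closed G E ->
    (Delta (restrict G X) (fun i => [set x : X | E i (val x)])
       <= Delta G E)%R.

End Strong.

(* For [X `<=` Y], the subpregeometry [X] of [G] is strong in the
   subpregeometry [Y] of [G]. *)
Definition strong_in (M : choiceType) (G : pregeometry M) (X Y : set M)
    : Prop :=
  strong (restrict G Y) [set y : Y | X (val y)].

Definition nstrong (M : choiceType) (G : pregeometry M) (n : nat)
    (X : set M) : Prop :=
  strong_star G X /\
  forall Y : set M, X `<=` Y -> strong_star G Y -> (Y `\` X #<= `I_n)%card ->
    strong_in G X Y.

(* That a subset [A] of [G] is strong in a finite pregeometry [B] living on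
   another type is given by an embedding [e] of [A] in [B] with strong image;
   that [f] fixes [A] pointwise is then [f (e a) = a]. *)
Definition generic (M : choiceType) (G : pregeometry M) : Prop :=
  [/\ countable [set: M],
      (forall A : set M, finite_set A -> strong G A -> flat (restrict G A)) /\
      (forall (T : finType) (B : pregeometry T), flat B ->
         exists f : T -> M, embedding B G f /\ strong G (range f)),
      (forall A : set M, finite_set A -> strong G A ->
       forall (T : finType) (B : pregeometry T) (e : A -> T), flat B ->
         embedding (restrict G A) B e -> strong B (range e) ->
         exists f : T -> M,
           [/\ embedding B G f, (forall a : A, f (e a) = val a) &
               strong G (range f)]) &
      forall X : set M, finite_set X ->
        exists A : set M, [/\ finite_set A, X `<=` A & strong G A]].

(* [formula k] : formulas with free variables among ['I_k]; in
   [Fall phi] the bound variable is [ord0]. *)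
Inductive formula : nat -> Type :=
| Fbot k : formula k
| Feq k : 'I_k -> 'I_k -> formula k
| FI k n : n.-tuple 'I_k -> formula k
| Fimp k : formula k -> formula k -> formula k
| Fall k : formula k.+1 -> formula k.

Record Lstruct := {
  dom :> choiceType;
  relI : forall n, n.-tuple dom -> Prop
}.

Definition vcons (T : Type) (k : nat) (x : T) (v : 'I_k -> T) : 'I_k.+1 -> T :=
  fun i => if unlift ord0 i is Some j then v j else x.

Fixpoint sat (S : Lstruct) k (phi : formula k) : ('I_k -> S) -> Prop :=
  match phi with
  | Fbot _ => fun _ => False
  | Feq _ i j => fun v => v i = v j
  | FI _ n t => fun v => relI (map_tuple v t)
  | Fimp _ phi1 phi2 => fun v => sat phi1 v -> sat phi2 v
  | Fall _ phi1 => fun v => forall x : S, sat phi1 (vcons x v)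
  end.

Definition sentence := formula 0.
Definition theory := set sentence.

Definition no_var (T : Type) (i : 'I_0) : T :=
  False_rect T (notF (ltn_ord i)).

Definition holds (S : Lstruct) (phi : sentence) : Prop := sat phi (@no_var S).

Definition models (S : Lstruct) (T : theory) : Prop :=
  forall phi, T phi -> holds S phi.

Definition satisfiable (T : theory) : Prop := exists S, models S T.

Definition entails (T : theory) (phi : sentence) : Prop :=
  forall S, models S T -> holds S phi.

Definition theory_equiv (T1 T2 : theory) : Prop :=
  forall S, models S T1 <-> models S T2.

Definition complete (T : theory) : Prop :=
  satisfiable T /\
  forall phi : sentence, entails T phi \/ entails T (Fimp phi (Fbot 0)).

Definition Th (S : Lstruct) : theory := [set phi | holds S phi].

(* An independent n-tuple lists n distinct elements. *)
Definition indep_tuple (M : choiceType) (G : pregeometry M) (n : nat)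
    (t : n.-tuple M) : Prop :=
  uniq t /\ indep G [fset x in tval t]%fset.

Definition struct_of (M : choiceType) (G : pregeometry M) : Lstruct :=
  {| dom := M; relI := @indep_tuple M G |}.

Definition interprets (S : Lstruct) (G : pregeometry S) : Prop :=
  forall n (t : n.-tuple S), relI t <-> indep_tuple G t.

Definition extension_axiom (tau : nat -> nat) (M : choiceType)
    (G : pregeometry M) : Prop :=
  forall F : set M, finite_set F -> strong_star G F ->
  forall (T : finType) (H : pregeometry T) (e : F -> T), flat H ->
    embedding (restrict G F) H e -> strong H (range e) ->
  forall n : nat, nstrong G (tau (#|T| + n)%N) F ->
    exists f : T -> M,
      [/\ embedding H G f, (forall a : F, f (e a) = val a) &
          nstrong G n (range f)].

Definition T_axioms (tau : nat -> nat) (S : Lstruct) : Prop :=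
  exists G : pregeometry S,
    [/\ interprets G, flat G, ~ fin_dim G [set: S] & extension_axiom tau G].

(* The first-order theory of the structures satisfying the axioms; that its
   models are exactly these structures is part of the main statement. *)
Definition T_ (tau : nat -> nat) : theory :=
  [set phi | forall S, T_axioms tau S -> holds S phi].

(* Main.v *)
Require Import Defs.
From mathcomp Require Import all_boot.
From mathcomp Require Import order ssralg ssrnum ssrint finmap.
From mathcomp Require Import boolp classical_sets cardinality filter.
From mathcomp Require Import zify ring lra.

Set Implicit Arguments.
Unset Strict Implicit.
Unset Printing Implicit Defensive.

Import Order.TTheory GRing.Theory Num.Theory.

Local Open Scope classical_set_scope.

(** Why the theorem holds.

    Everything follows from two facts.  First, the defining conditions of the
    theory are first-order (models_T_axioms): a structure satisfying every
    sentence true in all structures with these conditions has them itself.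
    Second, a structure with these conditions satisfies the same sentences as
    the generic pregeometry (T_axioms_elementary).  Hence, as soon as it is
    satisfiable, the theory is Th(G), whatever the bound tau.

    First-order conditions.  Write v for a finite tuple.  The pregeometry
    induced on v takes finitely many values, so any property of it is
    definable (def_pull).  The dimension of an intersection of closures of
    subtuples is at least n iff some independent n-tuple lies in all these
    closures, which is definable too (nat_def_dim).  Flatness, the relations
    strong_star and nstrong n on finite sets, and each instance of the
    extension condition are finite combinations of such statements.

    Elementary equivalence.  Replace the structure by an ultrapower over a
    free ultrafilter on nat: it has the same theory, hence still satisfies the
    conditions, and it is countably saturated.  In both the ultrapower and the
    generic pregeometry, every finite set lies in a finite strong flat set, and
    strong extensions of finite strong sets are realized by strong embeddings.
    So isomorphisms between finite strong subsets form a back-and-forth system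
    (strong_iso_forth).  In the ultrapower the extension condition gives, for
    each n, an embedding with n-strong image; saturation gives one that works
    for all n, and in a flat pregeometry a finite set that is n-strong for all
    n is strong (nstrong_strong).

    The combinatorial core is exists_strong: in a flat pregeometry every
    finite set X lies in a finite strong set.  For k > 0 let d_k(X) be the least
    alternating sum Delta of a family of flats of rank at most k whose union
    contains X.  By induction on k one builds a finite Y containing X such
    that no family of flats of rank at most k witnesses a failure of strength
    and such that d_k(Y) <= d_k(X).  For the step, take an optimal family for
    X, split it into flats CC of rank k+1 and a family W of rank at most k,
    with Delta(W) as small as possible.  Finitely many points of the union of W
    then see the correct value of Delta on each trace of W on a member of CC
    (capture), because a cheaper covering of these points could be merged into
    W.  Closing these points at rank k keeps everything optimal, and
    optimality of CC and W forces strength at rank k+1 (strong_next).  For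
    k > rk(X) the set Y stays inside the closure of X, where all flats have
    rank at most rk(X), so that Y is strong. *)

(** * Closure and dimension in a pregeometry *)

Section Basics.
Context (M : choiceType) (G : pregeometry M).
Implicit Types (A B C : {fset M}) (X Y Z : set M).

Lemma rk_mono A B : (A `<=` B)%fset -> (rk G A <= rk G B)%N.
Proof.
move=> /fsetUidPr <-; elim/finSet_rect: B => B IH.
have [->|[x xB]] := fset_0Vmem B; first by rewrite fsetU0.
have -> : (A `|` B = (A `|` (B `\ x)) `|` [fset x])%fset.
  by rewrite -fsetUA [((B `\ x) `|` _)%fset]fsetUC fsetD1K.
apply: leq_trans (rk_incr G _ _).1; apply: IH.
exact: fproperD1.
Qed.

Lemma rkU_le A B : (rk G (A `|` B)%fset <= rk G A + #|` B|)%N.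
Proof.
elim/finSet_rect: B => B IH.
have [->|[x xB]] := fset_0Vmem B; first by rewrite fsetU0 leq_addr.
have -> : (A `|` B = (A `|` (B `\ x)) `|` [fset x])%fset.
  by rewrite -fsetUA [((B `\ x) `|` _)%fset]fsetUC fsetD1K.
apply: leq_trans (rk_incr G _ _).2 _.
rewrite [in leqRHS](cardfsD1 x) xB add1n addnS ltnS.
by apply: IH; exact: fproperD1.
Qed.

Lemma rk_card A : (rk G A <= #|` A|)%N.
Proof. by have := rkU_le fset0 A; rewrite fset0U rk0. Qed.

Lemma indep_sub A B : (A `<=` B)%fset -> indep G B -> indep G A.
Proof.
move=> sAB; rewrite /indep => iB; apply/eqP; rewrite eqn_leq rk_card /=.
have := rkU_le A (B `\` A)%fset.
rewrite fsetUDl fsetDv fsetD0 (fsetUidPr _ _ sAB) iB cardfsD.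
rewrite (fsetIidPr sAB); have := fsubset_leq_card sAB; lia.
Qed.

Lemma clfP A x : clf G A x <-> (rk G (A `|` [fset x])%fset <= rk G A)%N.
Proof.
split=> [->//|h]; apply/eqP; rewrite eqn_leq h rk_mono //.
exact: fsubsetUl.
Qed.

Lemma clf_mono A B x : (A `<=` B)%fset -> clf G A x -> clf G B x.
Proof.
move=> sAB cA; apply/clfP.
have := rk_submod G (A `|` [fset x])%fset B.
have -> : ((A `|` [fset x]) `|` B = B `|` [fset x])%fset.
  by rewrite fsetUAC (fsetUidPr _ _ sAB).
have : (rk G A <= rk G ((A `|` [fset x]) `&` B)%fset)%N.
  by apply: rk_mono; rewrite fsubsetI fsubsetUl.
rewrite cA; lia.
Qed.

Lemma mem_clf A x : x \in A -> clf G A x.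
Proof.
by move=> xA; rewrite /clf /= (fsetUidPl _ _ _) // fsub1set.
Qed.

Lemma rk_clfU A B : (forall x, x \in B -> clf G A x) ->
  rk G (A `|` B)%fset = rk G A.
Proof.
elim/finSet_rect: B => B IH cB.
have [->|[x xB]] := fset_0Vmem B; first by rewrite fsetU0.
have -> : (A `|` B = (A `|` (B `\ x)) `|` [fset x])%fset.
  by rewrite -fsetUA [((B `\ x) `|` _)%fset]fsetUC fsetD1K.
have -> : rk G ((A `|` (B `\ x)) `|` [fset x])%fset = rk G (A `|` (B `\ x))%fset.
  by apply: (@clf_mono A _ x _ (cB _ xB)); exact: fsubsetUl.
apply: IH => [|y]; first exact: fproperD1.
by rewrite in_fsetD1 => /andP[_ /cB].
Qed.

Lemma clf_trans A B y :
  (forall x, x \in B -> clf G A x) -> clf G B y -> clf G A y.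
Proof.
move=> cB cy; apply/clfP; rewrite -[leqRHS](rk_clfU cB).
have : clf G (A `|` B)%fset y by apply: clf_mono cy; exact: fsubsetUr.
move=> <-; apply: rk_mono; apply: fsetSU; exact: fsubsetUl.
Qed.

Lemma clE A : cl G [set` A] = clf G A.
Proof.
apply/seteqP; split=> x; last by move=> cA; exists A; split.
by case=> B [sB cB]; apply: clf_mono cB; apply/fsubsetP => y; exact: sB.
Qed.

Lemma cl_mono X Y : X `<=` Y -> cl G X `<=` cl G Y.
Proof. by move=> sXY x [A [sA cA]]; exists A; split => // y /sA/sXY. Qed.

Lemma sub_cl X : X `<=` cl G X.
Proof.
move=> x Xx; exists [fset x]%fset; split.
  by move=> y /=; rewrite in_fset1 => /eqP ->.
by apply: mem_clf; rewrite in_fset1.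
Qed.

Lemma cl_fin X B : [set` B] `<=` cl G X ->
  exists A, [set` A] `<=` X /\ forall x, x \in B -> clf G A x.
Proof.
elim/finSet_rect: B => B IH sB.
have [->|[x xB]] := fset_0Vmem B.
  by exists fset0; split=> // x; rewrite in_fset0.
have [|y|A [sA cA]] := IH (B `\ x)%fset; first exact: fproperD1.
  by rewrite /= in_fsetD1 => /andP[_]; exact: sB.
have [A' [sA' cA']] := sB x xB.
exists (A `|` A')%fset; split.
  by move=> y /=; rewrite in_fsetU => /orP[/sA|/sA'].
move=> y yB; have [->|nyx] := eqVneq y x.
  by apply: clf_mono cA'; exact: fsubsetUr.
apply: (@clf_mono A); first exact: fsubsetUl.
by apply: cA; rewrite in_fsetD1 nyx.
Qed.

Lemma cl_idem X : cl G (cl G X) = cl G X.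
Proof.
apply/seteqP; split; last exact: sub_cl.
move=> x [B [/cl_fin[A [sA cA]] cB]]; exists A; split=> //.
exact: clf_trans cA cB.
Qed.

Lemma closed_cl X : is_closed G (cl G X). Proof. exact: cl_idem. Qed.

Lemma cl_min X Y : is_closed G Y -> X `<=` Y -> cl G X `<=` Y.
Proof. by move=> cY /cl_mono; rewrite cY. Qed.

Lemma closedI X Y : is_closed G X -> is_closed G Y -> is_closed G (X `&` Y).
Proof.
move=> cX cY; apply/seteqP; split; last exact: sub_cl.
by move=> x cx; split; [rewrite -cX|rewrite -cY]; apply: cl_mono cx => y [].
Qed.

(** Dimension arguments on infinite sets are reduced to a finite spanning
    set, whose rank is computed by rk. *)
Definition spans B Y := [set` B] `<=` Y /\ Y `<=` clf G B.

Lemma fin_dim_basis Y : fin_dim G Y -> exists2 B, indep G B & spans B Y.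
Proof.
move=> [n bn].
have ex : exists m, `[< indep_sizes G Y m >].
  exists 0%N; apply/asboolP; exists fset0; split; rewrite ?cardfs0 //.
  by rewrite /indep rk0 cardfs0.
have ub m : `[< indep_sizes G Y m >] -> (m <= n)%N by move/asboolP/bn.
case: (ex_maxnP ex ub) => m /asboolP [B [iB sB mE]] mmax.
exists B => //; split=> // x Yx; apply/clfP; rewrite leqNgt; apply/negP => h.
have := rk_incr G B x; set B' := (B `|` _)%fset in h * => -[_ h2].
have cB' : (#|` B'| <= #|` B|.+1)%N.
  by rewrite (leq_trans (leq_card_fsetU _ _)) // cardfs1 addn1.
have iB' : indep G B'.
  apply/eqP; rewrite eqn_leq rk_card (leq_trans cB') //.
  by rewrite -iB; exact: h.
have /mmax : `[< indep_sizes G Y #|` B'| >].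
  apply/asboolP; exists B'; split=> // y /=.
  by rewrite in_fsetU in_fset1 => /orP[/sB//|/eqP->].
by rewrite mE -iB' -iB leqNgt h.
Qed.

(** Independent subsets of Y lie in the closure of B, so they have at most
    rk(B) elements, and a maximal one attains this bound. *)
Lemma spans_dim B Y : spans B Y -> fin_dim G Y /\ dim G Y = rk G B.
Proof.
move=> [sB cB].
have bd m : indep_sizes G Y m -> (m <= rk G B)%N.
  case=> A [<- sA ->]; rewrite -(@rk_clfU B A) ?rk_mono ?fsubsetUr //.
  by move=> x /sA /cB.
have fY : fin_dim G Y by exists (rk G B).
split=> //; rewrite /dim /edim asboolT //=.
have [A iA [sA cA]] := fin_dim_basis fY.
have AB : rk G A = rk G B.
  rewrite -(@rk_clfU A B); last by move=> x /sB /cA.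
  rewrite fsetUC -[in RHS](@rk_clfU B A) //.
  by move=> x /sA /cB.
have inA : indep_sizes G Y (rk G B).
  by exists A; split=> //; rewrite -AB iA.
have isup : supremums (indep_sizes G Y) (rk G B).
  split=> [m /bd //| m /(_ _ inA)//].
rewrite /supremum ifF; last by apply/eqP => e0; rewrite e0 in inA.
exact: xget_subset1 isup (@is_subset1_supremums _ _ _).
Qed.
End Basics.

Section Dimension.
Context (M : choiceType) (G : pregeometry M).
Implicit Types (A B C : {fset M}) (X Y Z : set M).

Lemma fin_dim_sub X Y : X `<=` Y -> fin_dim G Y -> fin_dim G X.
Proof.
move=> sXY [n bn]; exists n => m [A [iA sA ->]]; apply: bn; exists A.
by split=> //; exact: subset_trans sXY.
Qed.

Lemma spans_fset A : spans G A [set` A].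
Proof. by split=> // x; exact: mem_clf. Qed.

Lemma fin_dim_fset A : fin_dim G [set` A].
Proof. by have [] := spans_dim (spans_fset A). Qed.

Lemma dim_fset A : dim G [set` A] = rk G A.
Proof. by have [] := spans_dim (spans_fset A). Qed.

Lemma fin_dim_spans Y : fin_dim G Y -> exists B, spans G B Y.
Proof. by move=> /fin_dim_basis[B _ sB]; exists B. Qed.

Lemma spans_cl B Y : spans G B Y -> spans G B (cl G Y).
Proof.
move=> [sB cB]; split; first exact: subset_trans (@sub_cl _ _ _).
rewrite -clE; apply: cl_min; first exact: closed_cl.
by rewrite clE.
Qed.

Lemma fin_dim_cl Y : fin_dim G Y -> fin_dim G (cl G Y).
Proof. by move=> /fin_dim_spans[B /spans_cl/spans_dim[]]. Qed.

Lemma dim_cl Y : fin_dim G Y -> dim G (cl G Y) = dim G Y.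
Proof.
move=> /fin_dim_spans[B sB].
by rewrite (spans_dim sB).2 (spans_dim (spans_cl sB)).2.
Qed.

Lemma dim_le X Y : X `<=` Y -> fin_dim G Y -> (dim G X <= dim G Y)%N.
Proof.
move=> sXY fY; have [A sA] := fin_dim_spans (fin_dim_sub sXY fY).
have [B sB] := fin_dim_spans fY.
rewrite (spans_dim sA).2 (spans_dim sB).2.
rewrite -(@rk_clfU _ _ B A) ?rk_mono ?fsubsetUr // => x /sA.1/sXY.
exact: sB.2.
Qed.

Lemma dim_eq_sub X Y : X `<=` Y -> fin_dim G Y ->
  (dim G Y <= dim G X)%N -> Y `<=` cl G X.
Proof.
move=> sXY fY h y Yy; have [A sA] := fin_dim_spans (fin_dim_sub sXY fY).
apply: (cl_mono sA.1); rewrite clE; apply/clfP.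
rewrite -(spans_dim sA).2 -dim_fset; apply: leq_trans h.
apply: dim_le => // z /=; rewrite in_fsetU in_fset1 => /orP[/sA.1/sXY//|].
by move=> /eqP ->.
Qed.

Lemma edim_fin Y : fin_dim G Y -> edim G Y = Some (dim G Y).
Proof. by move=> fY; rewrite /dim /edim asboolT. Qed.

Lemma fin_dim_clf A : fin_dim G (clf G A).
Proof. by rewrite -clE; apply: fin_dim_cl; exact: fin_dim_fset. Qed.

Lemma closed_clf A : is_closed G (clf G A).
Proof. by rewrite -clE; exact: closed_cl. Qed.

Lemma dim_clf A : dim G (clf G A) = rk G A.
Proof. by rewrite -clE dim_cl ?dim_fset //; exact: fin_dim_fset. Qed.

Lemma sub_clf A : [set` A] `<=` clf G A.
Proof. by move=> x; exact: mem_clf. Qed.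

Lemma fin_dim0 : fin_dim G set0.
Proof.
have -> : set0 = [set` (fset0 : {fset M})] by apply/seteqP; split.
exact: fin_dim_fset.
Qed.

Lemma dim0 : dim G set0 = 0%N.
Proof.
have -> : set0 = [set` (fset0 : {fset M})] by apply/seteqP; split.
by rewrite dim_fset rk0.
Qed.
End Dimension.

(** * Inclusion-exclusion sums over lists of sets *)

Section InclusionExclusion.
Context (M : Type).
Implicit Types (E A B : set M) (s t V W : seq (set M)) (f g : set M -> int).
Local Open Scope ring_scope.

(** The inclusion-exclusion sum of f over the family of all A & E, E in s.
    The parameter A makes the recursion structural, and for fixed f and s the
    sum is again a function of a set: iterating the construction over two
    lists gives the sum over pairwise intersections. *)
Fixpoint incl_excl f s A : int :=
  if s is E :: s' then
    f (A `&` E) + incl_excl f s' A - incl_excl f s' (A `&` E)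
  else 0.

(** Only the lower set generated by a family matters for its
    inclusion-exclusion sum (eq_ie); this is the comparison of lower sets. *)
Definition below s t := {in s, forall E, exists2 F, F \in t & E `<=` F}.

Lemma ie_cat f s t A :
  incl_excl f (s ++ t) A
  = incl_excl f s A + incl_excl f t A - incl_excl (incl_excl f t) s A.
Proof. by elim: s A => [|E s IH] A /=; [lia | rewrite !IH; lia]. Qed.

Lemma ieB f g s A :
  incl_excl (fun B => f B - g B) s A = incl_excl f s A - incl_excl g s A.
Proof. by elim: s A => [|E s IH] A //=; rewrite ?IH ; lia. Qed.

Lemma ieD f g s A :
  incl_excl (fun B => f B + g B) s A = incl_excl f s A + incl_excl g s A.
Proof. by elim: s A => [|E s IH] A //=; rewrite ?IH ; lia. Qed.

Lemma ie_trace f E s A :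
  incl_excl (fun B => f (B `&` E)) s A = incl_excl f s (A `&` E).
Proof. by elim: s A => [|F s IH] A //=; rewrite !IH (setIAC A F E). Qed.

Lemma ie0 s A : incl_excl (fun=> 0) s A = 0.
Proof. by elim: s A => [|F s IH] A //=; rewrite !IH; lia. Qed.

(** Both sides sum f over the intersections of a member of s with a member of
    t. *)
Lemma ie_comm f s t A :
  incl_excl (incl_excl f t) s A = incl_excl (incl_excl f s) t A.
Proof.
elim: t A => [|E t IH] A /=; first exact: ie0.

rewrite (@ieB (fun A => f (A `&` E) + incl_excl f t A)
   (fun A => incl_excl f t (A `&` E))).
rewrite (@ieD (fun A => f (A `&` E)) (incl_excl f t)).
by rewrite !ie_trace !IH.
Qed.

Lemma ie_map f E s A :
  incl_excl f [seq E `&` F | F <- s] A = incl_excl f s (A `&` E).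
Proof.
by elim: s A => [|F s IH] A //=; rewrite !IH setIA (setIAC _ F E) -(setIA A E E) setIid.
Qed.

Lemma ie_absorb f s A F : F \in s -> A `<=` F -> incl_excl f s A = f A.
Proof.
elim: s A => [|E s IH] A //=; rewrite inE => /orP[/eqP<-|Fs] sA.
  by rewrite (setIidl sA); lia.
rewrite !IH //; first lia.
by apply: subset_trans sA; exact: subIsetl.
Qed.

Lemma eq_ie_in f g s A :
  (forall B E, E \in s -> B `<=` E -> B `<=` A -> f B = g B) ->
  incl_excl f s A = incl_excl g s A.
Proof.
elim: s A => [|E s IH] A //= h.
rewrite (h _ E) ?mem_head ?IH //; try exact: subIsetr; try exact: subIsetl.
- move=> B F Fs BF BAE; apply: (h B F) => //; first by rewrite inE Fs orbT.
  by apply: subset_trans BAE _; exact: subIsetl.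
- by move=> B F Fs; apply: h; rewrite inE Fs orbT.
Qed.

Lemma ie_cat_below f s t A : below s t -> incl_excl f (s ++ t) A = incl_excl f t A.
Proof.
move=> st; rewrite ie_cat (@eq_ie_in _ f); first lia.
move=> B E /st [F Ft EF] BE _.
by apply: ie_absorb Ft _; exact: subset_trans BE EF.
Qed.

Lemma eq_ie f s t A : below s t -> below t s -> incl_excl f s A = incl_excl f t A.
Proof.
move=> st ts; rewrite -(ie_cat_below f A st) -[LHS](ie_cat_below f A ts).
by rewrite !ie_cat ie_comm; lia.
Qed.

Definition pairmeets V W : seq (set M) := [seq E `&` F | E <- W, F <- V].

(** The inner sum of f over V, evaluated below a member of V, is f itself, so
    the members E & F of the list of meets can be absorbed one E at a time. *)
Lemma ie_pairmeets f V W A :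
  incl_excl f (pairmeets V W) A = incl_excl (incl_excl f V) W A.
Proof.
elim: W A => [|E W IH] A //=.
have -> : pairmeets V (E :: W) = [seq E `&` F | F <- V] ++ pairmeets V W by [].
rewrite ie_cat ie_map IH; congr (_ - _).
rewrite ie_map ie_comm -IH; apply: eq_ie_in => B C.
case/allpairsP => -[F1 F2] /= [F1W F2V ->] BF _.
by apply: ie_absorb F2V _; apply: subset_trans BF _; exact: subIsetr.
Qed.

(** The modular law: the sum behaves like a valuation on lower sets. *)
Lemma ie_cat_pairmeets f V W A : incl_excl f (V ++ W) A =
  incl_excl f V A + incl_excl f W A - incl_excl f (pairmeets V W) A.
Proof. by rewrite ie_pairmeets ie_cat ie_comm. Qed.

Lemma below_pairmeetsl V W : below (pairmeets V W) V.
Proof.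
move=> E /allpairsP => -[[F1 F2] /= [F1W F2V ->]]; by exists F2.
Qed.

Lemma below_pairmeetsr V W : below (pairmeets V W) W.
Proof.
move=> E /allpairsP => -[[F1 F2] /= [F1W F2V ->]]; by exists F1.
Qed.
End InclusionExclusion.

(** * Families of flats in a flat pregeometry *)

Section Closure.
Context (M : choiceType) (G : pregeometry M).
Implicit Types (A B : {fset M}) (X Y Z C D E F : set M) (s t V W : seq (set M)).
Local Open Scope ring_scope.

Definition dimz (A : set M) : int := (dim G A)%:Z.
Definition fd_flat (E : set M) : Prop := is_closed G E /\ fin_dim G E.
Definition fd_family s : Prop := {in s, forall E, fd_flat E}.
Definition ranked (j : nat) s : Prop :=
  {in s, forall E, fd_flat E /\ (dim G E <= j)%N}.
Definition sunion s : set M := [set x | exists2 E, E \in s & E x].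
Local Notation incl d s := (incl_excl d s setT).

Definition flat_family : Prop :=
  forall s, fd_family s -> dimz (sunion s) <= incl dimz s.

Lemma fd_flatI C E : is_closed G C -> fd_flat E -> fd_flat (C `&` E).
Proof.
move=> cC [cE fE]; split; first exact: closedI.
by apply: fin_dim_sub fE; exact: subIsetr.
Qed.

Lemma fd_flat_clf A : fd_flat (clf G A).
Proof. by split; [exact: closed_clf|exact: fin_dim_clf]. Qed.

Lemma fd_family_map C s : is_closed G C -> fd_family s ->
  fd_family [seq C `&` E | E <- s].
Proof. by move=> cC fs E /mapP[F Fs ->]; apply: fd_flatI => //; exact: fs. Qed.

Lemma fd_family_cat s t : fd_family s -> fd_family t -> fd_family (s ++ t).
Proof. by move=> fs ft E; rewrite mem_cat => /orP[/fs|/ft]. Qed.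

Lemma ranked_fd j s : ranked j s -> fd_family s.
Proof. by move=> rs E /rs[]. Qed.

Lemma ranked_cat j s t : ranked j s -> ranked j t -> ranked j (s ++ t).
Proof. by move=> fs ft E; rewrite mem_cat => /orP[/fs|/ft]. Qed.

Lemma rankedW i j s : (i <= j)%N -> ranked i s -> ranked j s.
Proof. by move=> ij rs E /rs[? dE]; split=> //; exact: leq_trans dE ij. Qed.

Lemma ranked_map j C s : is_closed G C -> ranked j s ->
  ranked j [seq C `&` E | E <- s].
Proof.
move=> cC rs E /mapP[F /rs[fF dF] ->]; split; first exact: fd_flatI.
by apply: leq_trans dF; apply: dim_le fF.2; exact: subIsetr.
Qed.

Lemma ranked_pairmeets j V W : fd_family V -> ranked j W -> ranked j (pairmeets V W).
Proof.
move=> fV rW E /allpairsP[[F1 F2] /= [/rW[f1 d1] /fV f2 ->]]; split.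
  by apply: fd_flatI => //; exact: f1.1.
by apply: leq_trans d1; apply: dim_le f1.2; exact: subIsetl.
Qed.

Lemma fin_dim_sunion s : fd_family s -> fin_dim G (sunion s).
Proof.
elim: s => [|E s IH] fs.
  suff -> : sunion [::] = set0 by exact: fin_dim0.
  by apply/seteqP; split=> // x [].
have [|A sA] := fin_dim_spans (IH _); first by move=> F Fs; apply: fs; rewrite inE Fs orbT.
have [B sB] := fin_dim_spans (fs E (mem_head _ _)).2.
apply: fin_dim_sub (fin_dim_clf G (A `|` B)%fset) => x [F].
rewrite inE => /orP[/eqP->|Fs] Fx.
  by apply: clf_mono (sB.2 _ Fx); exact: fsubsetUr.
by apply: (clf_mono _ (sA.2 x _)); [exact: fsubsetUl|exists F].
Qed.

Lemma sunionS s t : {subset s <= t} -> sunion s `<=` sunion t.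
Proof. by move=> st x [E /st Et Ex]; exists E. Qed.

Lemma below_mem s t : {subset s <= t} -> below s t.
Proof. by move=> st E /st Et; exists E. Qed.

Lemma eq_ie_mem (f : set M -> int) s t X : s =i t ->
  incl_excl f s X = incl_excl f t X.
Proof. by move=> st; apply: eq_ie; apply: below_mem => E; rewrite st. Qed.

(** A flat F not containing C meets C in a proper flat of C, which has
    smaller rank. *)
Lemma ranked_cut k C s : fd_flat C -> (dim G C <= k.+1)%N -> fd_family s ->
  (forall F, F \in s -> ~ (C `<=` F)) -> ranked k [seq C `&` E | E <- s].
Proof.
move=> fC dC fs nC E /mapP[F Fs ->].
have fF := fd_flatI fC.1 (fs F Fs); split=> //.
rewrite -ltnS; apply: leq_trans dC; rewrite ltnNge; apply/negP => h.
apply: (nC F Fs); have := dim_eq_sub (@subIsetl _ C F) fC.2 h.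
by rewrite fF.1 => /subset_trans; apply; exact: subIsetr.
Qed.

Section Flat.
Hypothesis flatG : flat_family.

Lemma ie_flat_ge s C : is_closed G C -> fd_family s ->
  dimz (C `&` sunion s) <= incl_excl dimz s C.
Proof.
move=> cC fs; have := flatG (fd_family_map cC fs); rewrite ie_map setTI.
apply: le_trans; rewrite lez_nat; apply: dim_le.
  by move=> x [Cx [E Es Ex]]; exists (C `&` E); [exact: map_f|].
exact: fin_dim_sunion (fd_family_map cC fs).
Qed.

(** Closed sets are strong: adding C to s changes the sum by d(C) minus the
    left-hand side, and flatness bounds the new sum below by d(C). *)
Lemma ie_cut_le s C : fd_flat C -> fd_family s ->
  incl_excl dimz s C <= incl dimz s.
Proof.
move=> fC fs.
have fam : fd_family (C :: s).
  by move=> E; rewrite inE => /orP[/eqP->|/fs].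
have := flatG fam; rewrite /= setTI.
have : dimz C <= dimz (sunion (C :: s)).
  rewrite lez_nat; apply: dim_le; last exact: fin_dim_sunion.
  by move=> x Cx; exists C; rewrite ?mem_head.
lia.
Qed.

(** Adding a flat E that is spanned by points already covered changes the sum
    by d(E) minus the sum over the traces on E, which flatness bounds below by
    d(E). *)
Lemma ie_add_spanned s t : fd_family s -> fd_family t ->
  {in t, forall E, exists2 A, [set` A] `<=` sunion s & spans G A E} ->
  incl dimz (t ++ s) <= incl dimz s.
Proof.
move=> fs; elim: t => [|E t IH] //= ft sp.
have ft' : fd_family t by move=> F Ft; apply: ft; rewrite inE Ft orbT.
apply: le_trans (IH ft' _); last by move=> F Ft; apply: sp; rewrite inE Ft orbT.
rewrite setTI; have [A As sA] := sp E (mem_head _ _).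
have fE := ft E (mem_head _ _).
suff : dimz E <= incl_excl dimz (t ++ s) E by lia.
apply: le_trans (ie_flat_ge fE.1 (fd_family_cat ft' fs)).
rewrite lez_nat (spans_dim sA).2 -dim_fset; apply: dim_le.
  move=> x Ax; split; first exact: sA.1.
  by apply: (sunionS _ (As _ Ax)) => F; rewrite mem_cat orbC => ->.
by apply: fin_dim_sub fE.2; exact: subIsetl.
Qed.

Lemma ie_ge0 s : fd_family s -> 0 <= incl dimz s.
Proof. by move=> /flatG; apply: le_trans. Qed.

End Flat.

(** * Traces on a finite set and strength up to a given rank *)

Section Trace.
Variable Y : {fset M}.

Definition dim_onf (A : set M) : int := dimz (A `&` [set` Y]).
(** The sum of the defect over a family is the difference between Delta of
    the family and Delta of its trace on Y: strength of Y means that all these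
    sums are nonnegative. *)
Definition defect (A : set M) : int := dimz A - dim_onf A.

Lemma ie_defect s X : incl_excl defect s X = incl_excl dimz s X - incl_excl dim_onf s X.
Proof. exact: ieB. Qed.

Lemma defect_ge0 X : fin_dim G X -> 0 <= defect X.
Proof.
by move=> fA; rewrite subr_ge0 lez_nat; apply: dim_le fA; exact: subIsetl.
Qed.

Definition hull E : set M := cl G (E `&` [set` Y]).

Lemma hull_sub E : is_closed G E -> hull E `<=` E.
Proof. by move=> cE; apply: cl_min => //; exact: subIsetl. Qed.

Lemma hull_trace E : is_closed G E -> hull E `&` [set` Y] = E `&` [set` Y].
Proof.
move=> cE; apply/seteqP; split=> x [Ex Yx]; split=> //; first exact: hull_sub Ex.
exact: sub_cl.
Qed.

Lemma fd_flat_hull E : fd_flat E -> fd_flat (hull E).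
Proof.
move=> [cE fE]; split; first exact: closed_cl.
by apply: fin_dim_sub fE; exact: hull_sub.
Qed.

Lemma fin_dimIY E : fin_dim G (E `&` [set` Y]).
Proof. by apply: fin_dim_sub (fin_dim_fset G Y); exact: subIsetr. Qed.

Lemma defect_hull E : is_closed G E -> defect (hull E) = 0.
Proof.
move=> cE; rewrite /defect /dim_onf hull_trace // /dimz /hull dim_cl ?subrr //.
exact: fin_dimIY.
Qed.

Lemma ie_dim_onf_map (f : set M -> set M) s :
  {in s, forall E, f E `&` [set` Y] = E `&` [set` Y]} ->
  incl dim_onf (map f s) = incl dim_onf s.
Proof.
move=> h; rewrite /dim_onf !ie_trace setTI -[[set` Y]]setTI -!ie_map -map_comp.
by congr (incl_excl _ _ _); apply/eq_in_map => E /h /=; rewrite setIC [in RHS]setIC.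
Qed.

Definition strong_upto (j : nat) : Prop :=
  forall s, ranked j s -> 0 <= incl defect s.

(** Hulls have zero defect, so adding a hull to a family subtracts a sum of
    defects over flats of rank at most j; this is nonnegative. *)
Lemma ie_dim_onf_ge j s : strong_upto j -> ranked j s ->
  incl dimz (map hull s) <= incl dim_onf s.
Proof.
move=> sY rs; rewrite -(@ie_dim_onf_map hull); last first.
  by move=> E /rs[[cE _] _]; exact: hull_trace.
rewrite -subr_le0 -ie_defect.
elim: s rs => [|E s IH] rs //=.
have rs' : ranked j s by move=> F Fs; apply: rs; rewrite inE Fs orbT.
have [fE dE] := rs E (mem_head _ _).
rewrite setTI (defect_hull fE.1) -(setTI (hull E)) -ie_map.
have := IH rs'.
suff : 0 <= incl defect [seq hull E `&` F | F <- map hull s] by lia.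
apply: sY; apply: ranked_map; first exact: closed_cl.
move=> _ /mapP[F /rs'[fF dF] ->]; split; first exact: fd_flat_hull.
by apply: leq_trans dF; apply: dim_le fF.2; exact: hull_sub fF.1.
Qed.

Lemma sunion_hull s : sunion s `&` [set` Y] `<=` sunion (map hull s).
Proof.
move=> x [[E Es Ex] Yx]; exists (hull E); first exact: map_f.
exact: sub_cl.
Qed.

Lemma ranked_hull j s : ranked j s -> ranked j (map hull s).
Proof.
move=> rs _ /mapP[F /rs[fF dF] ->]; split; first exact: fd_flat_hull.
by apply: leq_trans dF; apply: dim_le fF.2; exact: hull_sub fF.1.
Qed.

(** Two flats of rank at most 1 are nested or meet in rank 0, where the defect
    vanishes; so the sum reduces to the defects of distinct flats. *)
Lemma strong_upto1 : strong_upto 1.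
Proof.
elim=> [|E s IH] rs //=.
have rs' : ranked 1 s by move=> F Fs; apply: rs; rewrite inE Fs orbT.
have [fE dE] := rs E (mem_head _ _).
rewrite setTI; have [[F Fs EF]|nF] := pselect (exists2 F, F \in s & E `<=` F).
  by rewrite (ie_absorb _ Fs EF); have := IH rs'; lia.
have r0 : ranked 0 [seq E `&` F | F <- s].
  apply: ranked_cut => //; first exact: ranked_fd rs'.
  by move=> F Fs EF; apply: nF; exists F.
have -> : incl_excl defect s E = 0.
  rewrite -(setTI E) -ie_map (@eq_ie_in _ _ (fun=> 0)) ?ie0 //.
  move=> B F /r0[fF dF] BF _; have fB := fin_dim_sub BF fF.2.
  have dB : dim G B = 0%N.
    by apply/eqP; rewrite -leqn0; apply: leq_trans dF; exact: dim_le fF.2.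
  have := defect_ge0 fB; rewrite /defect /dim_onf /dimz dB; lia.
have := IH rs'; have := defect_ge0 fE.2; lia.
Qed.
End Trace.
End Closure.

Lemma min_exists (T : Type) (P : T -> Prop) (h : T -> int) :
  (exists x, P x) -> (forall x, P x -> (0 <= h x)%R) ->
  exists x, P x /\ forall y, P y -> (h x <= h y)%R.
Proof.
move=> [x0 Px0] h0.
have ex : exists n, `[< exists2 x, P x & (h x = n%:Z)%R >].
  exists `|h x0|%N; apply/asboolP; exists x0 => //.
  by rewrite gez0_abs // h0.
case: (ex_minnP ex) => n /asboolP[x Px hx] nmin.
exists x; split=> // y Py; rewrite hx -(gez0_abs (h0 y Py)) lez_nat.
by apply: nmin; apply/asboolP; exists y => //; rewrite gez0_abs // h0.
Qed.

(** * Finite strong supersets *)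

Section Step.
Context (M : choiceType) (G : pregeometry M).
Implicit Types (A B : {fset M}) (X Z C D E F : set M) (s t V W U : seq (set M)).
Local Open Scope ring_scope.
Local Notation incl d s := (incl_excl d s setT).
Local Notation dz := (dimz G).
Hypothesis flatG : flat_family G.

Lemma family_bases s : fd_family G s -> exists B : {fset M}, [set` B] `<=` sunion s /\
  {in s, forall E, exists2 A, (A `<=` B)%fset & spans G A E}.
Proof.
elim: s => [|E s IH] fs; first by exists fset0; split.
have [|B [sB bB]] := IH; first by move=> F Fs; apply: fs; rewrite inE Fs orbT.
have [A sA] := fin_dim_spans (fs E (mem_head _ _)).2.
exists (A `|` B)%fset; split.
  move=> x /=; rewrite in_fsetU => /orP[/sA.1 Ex|/sB].
    by exists E; rewrite ?mem_head.
  by apply: sunionS => F Fs; rewrite inE Fs orbT.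
move=> F; rewrite inE => /orP[/eqP->|/bB[A' A'B sA']].
  by exists A => //; exact: fsubsetUl.
by exists A' => //; apply: fsubset_trans A'B _; exact: fsubsetUr.
Qed.

(** The last clause says that closing X up to Y does not increase the least
    value d_k of a covering by flats of rank at most k; the next step of the
    induction needs it to keep its family optimal. *)
Definition closes_up (k : nat) (X Y : {fset M}) : Prop :=
  [/\ (X `<=` Y)%fset, strong_upto G Y k &
   forall V, ranked G k V -> [set` X] `<=` sunion V ->
   exists V', [/\ ranked G k V', [set` Y] `<=` sunion V' & incl dz V' <= incl dz V]].

Section InductiveStep.
Variables (k : nat) (X : {fset M}).
Hypothesis k_gt0 : (0 < k)%N.
Hypothesis IHk : forall X : {fset M}, exists Y, closes_up k X Y.

Definition topflats (CC : seq (set M)) : Prop :=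
  uniq CC /\ {in CC, forall C, fd_flat G C /\ dim G C = k.+1}.

(** CC and W together form a family of value m covering X.  The pairwise
    meets of CC are put below W, so that each member of CC contributes its rank
    minus the sum of W on it, independently of the other members. *)
Definition presents (m : int) (CC W : seq (set M)) : Prop :=
  [/\ ranked G k W, [set` X] `<=` sunion W, topflats CC,
      {in CC &, forall C C', C != C' -> exists2 F, F \in W & C `&` C' `<=` F} &
      incl dz (CC ++ W) = m].

Lemma singletons : exists W, ranked G k W /\ [set` X] `<=` sunion W.
Proof.
exists [seq clf G [fset x]%fset | x <- X]; split.
  move=> _ /mapP[x xX ->]; split; first exact: fd_flat_clf.
  by rewrite dim_clf (leq_trans (rk_card _ _)) // cardfs1.
move=> x xX; exists (clf G [fset x]%fset); last by apply: mem_clf; rewrite in_fset1.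
by apply/mapP; exists x.
Qed.

Lemma presents_exists : exists m CC W,
  [/\ presents m CC W,
      forall V, ranked G k.+1 V -> [set` X] `<=` sunion V -> m <= incl dz V &
      forall W', presents m CC W' -> incl dz W <= incl dz W'].
Proof.
have [|s [[rs Xs] smin]] := @min_exists _ (fun V => ranked G k.+1 V /\ [set` X] `<=` sunion V)
    (fun V => incl dz V) _ (fun V h => ie_ge0 flatG (ranked_fd h.1)).
  by have [W [rW cW]] := singletons; exists W; split=> //; exact: rankedW rW.
pose CC := undup [seq C <- s | dim G C == k.+1].
have CCP C : C \in CC = (dim G C == k.+1) && (C \in s) by rewrite mem_undup mem_filter.
have tCC : topflats CC.
  split; first exact: undup_uniq.
  by move=> C; rewrite CCP => /andP[/eqP dC /rs[]].
pose P W := presents (incl dz s) CC W.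
have [||W [PW Wmin]] := @min_exists _ P (fun V => incl dz V).
- have [Z [rZ XZ]] := singletons.
  (* besides the members of rank at most k, W receives the pairwise meets of
     CC and small flats through the points of X; all lie below the family *)
  pose Z' := pairmeets s Z.
  pose mm := [seq E `&` F | E <- CC, F <- [seq F <- CC | F != E]].
  pose L := [seq C <- s | (dim G C <= k)%N].
  have rL : ranked G k L by move=> E; rewrite mem_filter => /andP[dE /rs[fE _]].
  have rmm : ranked G k mm.
    move=> D /allpairsPdep[E [F [ECC]]]; rewrite mem_filter => /andP[nFE FCC] ->.
    have [fE dE] := tCC.2 _ ECC; have [fF dF] := tCC.2 _ FCC.
    split; first by apply: fd_flatI => //; exact: fE.1.
    rewrite -ltnS -dE ltnNge; apply/negP => h.
    have EF : E `<=` F.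
      have := dim_eq_sub (@subIsetl _ E F) fE.2 h.
      rewrite (closedI fE.1 fF.1) => /subset_trans; apply; exact: subIsetr.
    have FE : F `<=` E.
      by have := dim_eq_sub EF fF.2; rewrite fE.1; apply; rewrite dE dF.
    by move/eqP: nFE; apply; apply/seteqP.
  exists (L ++ mm ++ Z'); split.
  + apply: ranked_cat => //; apply: ranked_cat => //.
    by apply: ranked_pairmeets => //; exact: ranked_fd rs.
  + move=> x Xx; have [E Es Ex] := Xs x Xx; have [F FZ Fx] := XZ x Xx.
    exists (F `&` E) => //; rewrite !mem_cat; apply/orP; right; apply/orP; right.
    by apply/allpairsP; exists (F, E).
  + exact: tCC.
  + move=> C C' CC1 CC2 nC; exists (C `&` C') => //.
    rewrite !mem_cat; apply/orP; right; apply/orP; left.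
    by apply/allpairsPdep; exists C, C'; split; rewrite // mem_filter eq_sym nC.
  + apply: eq_ie.
      move=> E; rewrite !mem_cat => /or4P[].
      * by rewrite CCP => /andP[_ Es]; exists E.
      * by rewrite mem_filter => /andP[_ Es]; exists E.
      * move=> /allpairsPdep[C [F [CC1 _ ->]]]; exists C; last exact: subIsetl.
        by move: CC1; rewrite CCP => /andP[].
      * exact: below_pairmeetsl.
    move=> E Es; exists E => //; rewrite !mem_cat CCP Es mem_filter Es.
    have [_] := rs E Es; rewrite leq_eqVlt ltnS => /orP[->//|->].
    by rewrite orbT.
- by move=> V [rV _ _ _ _]; apply: (ie_ge0 flatG); exact: ranked_fd rV.
by exists (incl dz s), CC, W; split=> // V rV XV; exact: smin.
Qed.

Section FixedSplit.
Variables (m : int) (CC W : seq (set M)).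
Hypothesis splitW : presents m CC W.
Hypothesis mmin : forall V, ranked G k.+1 V -> [set` X] `<=` sunion V -> m <= incl dz V.
Hypothesis Wmin : forall W', presents m CC W' -> incl dz W <= incl dz W'.

Let rW : ranked G k W. Proof. by case: splitW. Qed.
Let XW : [set` X] `<=` sunion W. Proof. by case: splitW. Qed.
Let uCC : uniq CC. Proof. by case: splitW => _ _ []. Qed.
Let tCC C : C \in CC -> fd_flat G C /\ dim G C = k.+1.
Proof. by case: splitW => _ _ [_ h] _ _ /h. Qed.
Let dimC C : C \in CC -> dz C = (k.+1)%:Z.
Proof. by move=> /tCC[_ dC]; rewrite /dimz dC. Qed.
Let CCW C C' : C \in CC -> C' \in CC -> C != C' ->
  exists2 F, F \in W & C `&` C' `<=` F.
Proof. by case: splitW => _ _ _ h _; exact: h. Qed.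
Let mE : incl dz (CC ++ W) = m. Proof. by case: splitW. Qed.

Lemma proper_top C C' : C \in CC -> C' \in CC -> C `<=` C' -> C = C'.
Proof.
move=> /tCC[fC dC] /tCC[fC' dC'] sCC'; apply/seteqP; split=> //.
by have := dim_eq_sub sCC' fC'.2; rewrite fC.1; apply; rewrite dC dC'.
Qed.

Lemma ie_other_tops C s : C \in CC -> {subset s <= CC} -> C \notin s ->
  incl_excl dz (s ++ W) C = incl_excl dz W C.
Proof.
move=> CC1 sCC nC; rewrite -(setTI C) -!ie_map map_cat; apply: ie_cat_below.
move=> _ /mapP[C' C's ->]; have [|F FW CF] := CCW CC1 (sCC _ C's).
  by apply: contraNneq nC => ->.
exists (C `&` F); first exact: map_f.
by move=> x Cx; split; [exact: Cx.1|exact: CF].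
Qed.

(** Otherwise dropping C from the family would lower its value below the
    optimum m. *)
Lemma top_count C : C \in CC -> (k.+1)%:Z <= incl_excl dz W C.
Proof.
move=> CC1; have [fC dC] := tCC CC1.
have e : incl dz (C :: (rem C CC ++ W)) = m.
  rewrite -mE; apply: eq_ie_mem => E.
  by rewrite -cat_cons !mem_cat (perm_mem (perm_to_rem CC1)).
have := mmin (V := rem C CC ++ W); rewrite -e /= setTI.
rewrite (ie_other_tops CC1) ?mem_rem_uniqF //; last by move=> E /mem_rem.
rewrite dimC // => h.
have : incl dz (rem C CC ++ W) >= (k.+1)%:Z + incl dz (rem C CC ++ W) - incl_excl dz W C.
  apply: h.
    apply: ranked_cat; last exact: rankedW rW.
    by move=> E /mem_rem/tCC[fE dE]; rewrite dE.
  apply: subset_trans XW _; apply: sunionS => E EW.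
  by rewrite mem_cat EW orbT.
lia.
Qed.

Lemma incl_tops s : {subset s <= CC} -> uniq s ->
  incl dz (s ++ W) = incl dz W + \sum_(C <- s) ((k.+1)%:Z - incl_excl dz W C).
Proof.
elim: s => [|C s IH] sCC; first by rewrite big_nil addr0.
move=> /= /andP[nC us]; have CC1 := sCC C (mem_head _ _).
have sCC' : {subset s <= CC} by move=> E Es; apply: sCC; rewrite inE Es orbT.
rewrite big_cons setTI (ie_other_tops CC1) // IH // dimC //; ring.
Qed.

Let S := \sum_(C <- CC) ((k.+1)%:Z - incl_excl dz W C).
Lemma opt_valueE : m = incl dz W + S. Proof. by rewrite -mE incl_tops. Qed.

Section Points.
Variable Y1 : {fset M}.
Hypothesis spY1 : {in CC & W, forall C F,
  exists A, (A `<=` Y1)%fset /\ spans G A (C `&` F)}.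

(** If V were a cheaper covering of the points of Y1 in C, add to its trace
    on C all meets of C with W, at no cost since Y1 spans them, and add the
    result to W.  As it lies below C, the value of CC ++ W is unchanged, while
    the value of W decreases, against the choice of W. *)
Lemma capture C V : C \in CC -> ranked G k V ->
  C `&` [set` Y1] `<=` sunion V -> incl_excl dz W C <= incl dz V.
Proof.
move=> CC1 rV YV; have [fC dC] := tCC CC1.
apply: le_trans (ie_cut_le flatG fC (ranked_fd rV)).
rewrite -(setTI C) -!ie_map.
set V1 := map _ V; set W1 := map _ W.
have rV1 : ranked G k V1 by apply: ranked_map => //; exact: fC.1.
have rW1 : ranked G k W1 by apply: ranked_map => //; exact: fC.1.
have YV1 : C `&` [set` Y1] `<=` sunion V1.
  move=> x xCY; have [E EV Ex] := YV x xCY.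
  by exists (C `&` E); [exact: map_f|split => //; exact: xCY.1].
(* the meets of C with W are spanned by points of Y1, which V1 covers *)
have le1 : incl dz (W1 ++ V1) <= incl dz V1.
  apply: (ie_add_spanned flatG); [exact: ranked_fd rV1|exact: ranked_fd rW1|].
  move=> _ /mapP[F FW ->]; have [A [AY sA]] := spY1 CC1 FW.
  exists A => // x xA; apply: YV1; split; first exact: (sA.1 _ xA).1.
  exact: (fsubsetP AY).
apply: le_trans le1.
have inC E : E \in W1 ++ V1 -> E `<=` C.
  by rewrite mem_cat => /orP[] /mapP[F _ ->].
(* compare W with W merged with the covering: their meet is W cut with C *)
have := Wmin (W' := (W1 ++ V1) ++ W).
rewrite (ie_cat_pairmeets _ (W1 ++ V1) W).
have -> : incl dz (pairmeets (W1 ++ V1) W) = incl dz W1.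
  apply: eq_ie.
    move=> _ /allpairsP[[F E] /= [FW /inC EC ->]].
    exists (C `&` F); first exact: map_f.
    by move=> x [Fx Ex]; split=> //; exact: EC.
  move=> _ /mapP[F FW ->]; exists (F `&` (C `&` F)); last by move=> x [Cx Fx].
  apply/allpairsP; exists (F, C `&` F); split=> //=.
  by rewrite mem_cat map_f.
suff : presents m CC ((W1 ++ V1) ++ W) by move=> h /(_ h); lia.
split.
- by apply: ranked_cat => //; exact: ranked_cat.
- apply: subset_trans XW _; apply: sunionS => E EW.
  by rewrite mem_cat EW orbT.
- by split=> // E /tCC.
- move=> C1 C2 h1 h2 h12; have [F FW sF] := CCW h1 h2 h12; exists F => //.
  by rewrite mem_cat FW orbT.
- rewrite -mE; apply: eq_ie.
    move=> E; rewrite mem_cat mem_cat => /or3P[EC|/inC EC|EW].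
    + by exists E => //; rewrite mem_cat EC.
    + by exists C => //; rewrite mem_cat CC1.
    + by exists E => //; rewrite mem_cat EW orbT.
  move=> E; rewrite mem_cat => EW; exists E => //.
  by rewrite !mem_cat; case/orP: EW => ->; rewrite ?orbT.
Qed.

Variables (Y : {fset M}) (WY : seq (set M)).
Hypotheses (XY1 : (X `<=` Y1)%fset) (Y1Y : (Y1 `<=` Y)%fset) (sY : strong_upto G Y k).
Hypotheses (rWY : ranked G k WY) (YWY : [set` Y] `<=` sunion WY).
Hypothesis leWY : incl dz WY <= incl dz W.

(** If the trace of C on Y had rank at most k, its hull alone would be a
    covering too cheap for capture and top_count. *)
Lemma dim_trace C : C \in CC -> dim G (C `&` [set` Y]) = k.+1.
Proof.
move=> CC1; have [fC dC] := tCC CC1; apply/eqP; rewrite eqn_leq -{1}dC.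
rewrite (dim_le (@subIsetl _ _ _) fC.2) /=.
rewrite ltnNge; apply/negP => h.
have := capture (V := [:: hull G Y C]) CC1.
rewrite /= setTI addr0 subr0 /dimz /hull dim_cl; last exact: fin_dimIY.
have := top_count CC1 => h1 /(_ _ _) h2.
suff : incl_excl dz W C <= (dim G (C `&` [set` Y]))%:Z by lia.
apply: h2.
  move=> E; rewrite inE => /eqP->; split; first exact: (@fd_flat_hull _ _ Y C fC).
  by rewrite dim_cl //; exact: fin_dimIY.
move=> x [Cx Y1x]; exists (hull G Y C); first by rewrite mem_head.
by apply: sub_cl; split=> //; exact: (fsubsetP Y1Y).
Qed.

Lemma defect_top C : C \in CC -> defect G Y C = 0.
Proof.
by move=> CC1; rewrite /defect /dim_onf /dimz dim_trace // (tCC CC1).2 subrr.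
Qed.

Lemma ranked_tops s C : C \in CC -> {subset s <= CC} -> C \notin s ->
  ranked G k [seq C `&` E | E <- s ++ WY].
Proof.
move=> CC1 sCC nC; have [fC dC] := tCC CC1; rewrite map_cat.
apply: ranked_cat; last by apply: ranked_map => //; exact: fC.1.
apply: ranked_cut => //; first by rewrite dC.
  by move=> E /sCC/tCC[].
by move=> F Fs /(proper_top CC1 (sCC _ Fs)) e; move: nC; rewrite e Fs.
Qed.

Lemma tops_dim_le s : {subset s <= CC} -> uniq s ->
  incl dz (s ++ WY)
    <= incl dz WY + \sum_(C <- s) ((k.+1)%:Z - incl_excl dz W C).
Proof.
elim: s => [|C s IH] sCC; first by rewrite big_nil addr0.
move=> /= /andP[nC us]; have CC1 := sCC C (mem_head _ _).
have sCC' : {subset s <= CC} by move=> E Es; apply: sCC; rewrite inE Es orbT.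
rewrite big_cons setTI dimC //.
have : incl_excl dz W C <= incl_excl dz (s ++ WY) C.
  rewrite -(setTI C) -(ie_map _ _ (s ++ WY)) setTI; apply: capture => //.
    exact: ranked_tops.
  move=> x [Cx /(fsubsetP Y1Y)/YWY[E EW Ex]]; exists (C `&` E) => //.
  by apply: map_f; rewrite mem_cat EW orbT.
have := IH sCC' us; lra.
Qed.

Lemma tops_dim_onf_le s : {subset s <= CC} -> uniq s ->
  incl (dim_onf G Y) (s ++ WY)
    <= incl (dim_onf G Y) WY + \sum_(C <- s) ((k.+1)%:Z - incl_excl dz W C).
Proof.
elim: s => [|C s IH] sCC; first by rewrite big_nil addr0.
move=> /= /andP[nC us]; have CC1 := sCC C (mem_head _ _).
have sCC' : {subset s <= CC} by move=> E Es; apply: sCC; rewrite inE Es orbT.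
rewrite big_cons setTI {1}/dim_onf {1}/dimz dim_trace //.
have : incl_excl dz W C <= incl_excl (dim_onf G Y) (s ++ WY) C.
  rewrite -[in leRHS](setTI C) -(ie_map _ _ (s ++ WY)).
  have rk1 := ranked_tops CC1 sCC' nC.
  apply: le_trans (ie_dim_onf_ge sY rk1); apply: capture => //.
    exact: ranked_hull.
  move=> x [Cx /(fsubsetP Y1Y) Yx]; apply: sunion_hull; split=> //.
  have [E EW Ex] := YWY Yx; exists (C `&` E) => //.
  by apply: map_f; rewrite mem_cat EW orbT.
have := IH sCC' us; lra.
Qed.

(** Given a family s of rank at most k+1, add CC (which lowers the sum of
    defects, as CC has zero defect) and then WY (which costs the sum of defects
    of WY, by strength at rank k).  The resulting family covers X, so its value
    is at least the optimum m; and its trace on Y has value at most that of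
    CC ++ WY, since Y is covered by WY and is flat up to rank k.  Comparing the
    two gives a bound that is nonnegative because WY is at most as costly as
    W. *)
Lemma strong_next : strong_upto G Y k.+1.
Proof.
move=> s rs.
have rCC t : {subset t <= CC} -> ranked G k.+1 t.
  by move=> tC E /tC/tCC[fE dE]; rewrite dE.
(* a member C of CC has zero defect, and its trace on the other flats either
   is C itself or has rank at most k *)
have stepA t : {subset t <= CC} -> incl (defect G Y) (t ++ s) <= incl (defect G Y) s.
  elim: t => [|C t IH] tC //=.
  have tC' : {subset t <= CC} by move=> E Et; apply: tC; rewrite inE Et orbT.
  have CC1 := tC C (mem_head _ _); have [fC dC] := tCC CC1.
  apply: le_trans (IH tC'); rewrite setTI defect_top // add0r lerBlDr lerDl.
  have rts : ranked G k.+1 (t ++ s) by apply: ranked_cat => //; exact: rCC.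
  have [[F Fs CF]|nF] := pselect (exists2 F, F \in t ++ s & C `<=` F).
    by rewrite (ie_absorb _ Fs CF) defect_top.
  rewrite -(setTI C) -ie_map; apply: sY; apply: ranked_cut => //.
  - by rewrite dC.
  - exact: ranked_fd rts.
  - by move=> F Fs CF; apply: nF; exists F.
set V := CC ++ s.
have rV : ranked G k.+1 V by apply: ranked_cat => //; exact: rCC.
have stepB : incl (defect G Y) (WY ++ V) <= incl (defect G Y) WY + incl (defect G Y) V.
  rewrite ie_cat -ie_pairmeets lerBlDr lerDl; apply: sY.
  exact: ranked_pairmeets (ranked_fd rV) rWY.
(* Y is covered by WY, so by flatness of Y up to rank k further flats do not
   increase the value of the trace *)
have stepC : incl (dim_onf G Y) (WY ++ V) <= incl (dim_onf G Y) (CC ++ WY).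
  have -> : incl (dim_onf G Y) (WY ++ V) = incl (dim_onf G Y) (s ++ (CC ++ WY)).
    by apply: eq_ie_mem => E; rewrite !mem_cat orbA orbC (orbC (_ \in CC)).
  elim: s rs {stepA V rV stepB} => [|D s IH] rs //=.
  have rs' : ranked G k.+1 s by move=> E Es; apply: rs; rewrite inE Es orbT.
  have [fD dD] := rs D (mem_head _ _).
  apply: le_trans (IH rs'); rewrite setTI.
  set U := s ++ _.
  suff : dim_onf G Y D <= incl_excl (dim_onf G Y) U D by lia.
  have rU : ranked G k.+1 U.
    apply: ranked_cat => //; apply: ranked_cat; first exact: rCC.
    exact: rankedW rWY.
  have [[F Fs CF]|nF] := pselect (exists2 F, F \in U & D `<=` F).
    by rewrite (ie_absorb _ Fs CF).
  have rDU : ranked G k [seq D `&` E | E <- U].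
    apply: ranked_cut => //; first exact: ranked_fd rU.
    by move=> F FU DF; apply: nF; exists F.
  rewrite -[in leRHS](setTI D) -ie_map.
  apply: le_trans (ie_dim_onf_ge sY rDU).
  apply: le_trans (flatG (ranked_fd (ranked_hull (Y:=Y) rDU))).
  rewrite lez_nat; apply: dim_le.
    move=> x [Dx Yx]; apply: sunion_hull; split=> //.
    have [E EW Ex] := YWY Yx; exists (D `&` E) => //.
    by apply: map_f; rewrite !mem_cat EW !orbT.
  exact: fin_dim_sunion (ranked_fd (ranked_hull (Y:=Y) rDU)).
have XU : [set` X] `<=` sunion (WY ++ V).
  move=> x /(fsubsetP XY1)/(fsubsetP Y1Y) /YWY; apply: sunionS => E EW.
  by rewrite mem_cat EW.
have := mmin (ranked_cat (rankedW (leqnSn k) rWY) rV) XU.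
have := tops_dim_onf_le (s := CC) (fun _ h => h) uCC.
move: stepB (stepA CC (fun _ h => h)) stepC.
rewrite !ie_defect -/V -/S opt_valueE; lia.
Qed.
End Points.
End FixedSplit.

Lemma closure_next : exists Y, closes_up k.+1 X Y.
Proof.
have [m [CC [W [sp mmin Wmin]]]] := presents_exists.
have [rW XW [uCC tCC] _ _] := sp.
have fdCC : fd_family G CC by move=> C /tCC[].
have [B [BW spB]] := family_bases (ranked_fd (ranked_pairmeets fdCC rW)).
have [Y [XY sY cov]] := IHk (X `|` B)%fset.
have XB : [set` (X `|` B)%fset] `<=` sunion W.
  move=> x /=; rewrite in_fsetU => /orP[/XW//|/BW[E /below_pairmeetsr[F FW EF] Ex]].
  by exists F => //; exact: EF.
have spY1 : {in CC & W, forall C F,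
    exists A, (A `<=` X `|` B)%fset /\ spans G A (C `&` F)}.
  move=> C F CC1 FW; have [|A AB sA] := spB (F `&` C).
    by apply/allpairsP; exists (F, C).
  exists A; rewrite setIC; split=> //.
  by apply: fsubset_trans AB _; exact: fsubsetUr.
have [WY [rWY YWY leWY]] := cov W rW XB.
have XX1 : (X `<=` X `|` B)%fset by exact: fsubsetUl.
exists Y; split.
- exact: fsubset_trans XX1 XY.
- exact: (strong_next sp mmin Wmin spY1 XX1 XY sY rWY YWY leWY).
move=> V rV XV; exists (CC ++ WY); split.
- apply: ranked_cat; last exact: rankedW rWY.
  by move=> E /tCC[fE ->].
- apply: subset_trans YWY _; apply: sunionS => E EW.
  by rewrite mem_cat EW orbT.
apply: le_trans (mmin V rV XV).
have := tops_dim_le sp Wmin spY1 XY rWY YWY (fun _ h => h) uCC.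
rewrite (opt_valueE sp); lra.
Qed.
End InductiveStep.

Lemma closure_upto k (X : {fset M}) : exists Y, closes_up k.+1 X Y.
Proof.
elim: k X => [|k IH] X; last exact: closure_next.
exists X; split=> //; first exact: strong_upto1.
by move=> V rV XV; exists V.
Qed.

Definition strong_fset (Y : {fset M}) : Prop :=
  forall s, fd_family G s -> 0 <= incl (defect G Y) s.

(** Close X up at rank k+1, where k is the rank of X.  The result Y satisfies
    rk(Y) <= d_(k+1)(Y) <= d_(k+1)(X) <= k, and every family can be cut with the
    closure of Y, after which its members have rank at most k. *)
Theorem exists_strong (X : {fset M}) : exists Y, (X `<=` Y)%fset /\ strong_fset Y.
Proof.
pose k := rk G X; have [Y [XY sY cov]] := closure_upto k X.
exists Y; split=> // s fs.
have [|x xX|V [rV YV leV]] := cov [:: clf G X].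
- move=> E; rewrite inE => /eqP->; split; first exact: fd_flat_clf.
  by rewrite dim_clf.
- by exists (clf G X); rewrite ?mem_head //; exact: mem_clf.
have rkY : (rk G Y <= k)%N.
  have /= := flatG (ranked_fd rV).
  have : (dim G [set` Y] <= dim G (sunion V))%N.
    by apply: dim_le YV _; exact: fin_dim_sunion (ranked_fd rV).
  move: leV; rewrite /= setTI /dimz dim_clf dim_fset -/k; lia.
have fC := fd_flat_clf G Y.
have : 0 <= incl (defect G Y) [seq clf G Y `&` E | E <- s].
  apply: sY => E /mapP[F /fs fF ->]; split; first by apply: fd_flatI => //; exact: fC.1.
  apply: leq_trans (dim_le (@subIsetl _ _ _) fC.2) _.
  by rewrite dim_clf; exact: leqW.
rewrite ie_map setTI ie_defect ie_defect.
have := ie_cut_le flatG fC fs.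
have -> : incl_excl (dim_onf G Y) s (clf G Y) = incl (dim_onf G Y) s.
  rewrite /dim_onf !ie_trace setTI; congr (incl_excl _ _ _).
  by rewrite setIidr //; exact: sub_clf.
lra.
Qed.
End Step.

(** * Alternating sums over subsets as inclusion-exclusion sums *)

Section DeltaInclExcl.
Context (M : Type).
Local Open Scope ring_scope.
Implicit Types (f : set M -> int).
Local Notation lifts t := (imset (lift ord0) (mem t)).
Local Notation lifts0 t := (finset.setU [set ord0]%SET (lifts t)).

Lemma big_set_ordS (k : nat) (F : {set 'I_k.+1} -> int) :
  \sum_s F s =
  \sum_(t : {set 'I_k}) F (lifts t) + \sum_(t : {set 'I_k}) F (lifts0 t).
Proof.
pose h (p : bool * {set 'I_k}) :=
  if p.1 then lifts0 p.2 else lifts p.2.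
pose h' (s : {set 'I_k.+1}) := (ord0 \in s, [set i | lift ord0 i \in s]%SET).
have n0 (t : {set 'I_k}) : ord0 \in lifts t = false.
  by apply/negbTE/imsetP => -[i _ /eqP]; rewrite (negbTE (neq_lift _ _)).
have lK (t : {set 'I_k}) i : (lift ord0 i \in lifts t) = (i \in t).
  by rewrite mem_imset //; exact: lift_inj.
rewrite (reindex h) /=; last first.
  exists h' => [[b t] _|s _]; rewrite /h /h' /=.
    case: b; congr (_, _); rewrite ?finset.in_setU1 ?eqxx ?n0 //; apply/setP => i.
      by rewrite inE finset.in_setU1 eq_sym (negbTE (neq_lift _ _)) lK.
    by rewrite inE lK.
  have e : lifts [set i | lift ord0 i \in s]%SET = (s :\ ord0)%SET.
    apply/setP => i; rewrite finset.in_setD1; case: (unliftP ord0 i) => [j|] ->.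
      by rewrite lK inE eq_sym neq_lift.
    by rewrite n0 eqxx.
  case: ifPn => h0; rewrite e; first by rewrite finset.setD1K.
  by apply/setP => i; rewrite finset.in_setD1; case: eqP => // ->; rewrite (negbTE h0).
rewrite -(pair_big predT predT (fun b t => F (h (b, t)))) /=.
by rewrite big_bool /= addrC.
Qed.

Lemma signed_sum_ie f k (E : 'I_k -> set M) A :
  \sum_(s : {set 'I_k})
     (-1) ^+ #|s| * f (A `&` \bigcap_(i in [set j | j \in s]) E i)
  = f A - incl_excl f (codom E) A.
Proof.
elim: k E A => [|k IH] E A.
  rewrite (eq_bigl (fun s => s == finset.set0)); last first.
    by move=> s; apply/esym/eqP/setP => -[].
  rewrite big_pred1_eq cards0 expr0 mul1r.
  have -> : codom E = [::].
    by apply/size0nil; rewrite size_codom card_ord.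
  rewrite /= subr0; congr f; apply/seteqP; split=> x; first by case.
  by move=> Ax; split=> // -[].
have -> : codom E = E ord0 :: codom (E \o lift ord0).
  by rewrite /codom /image_mem enum_ordSl /= -map_comp.
rewrite big_set_ordS /= /comp.
have -> : \sum_(t : {set 'I_k}) (-1) ^+ #|lifts t| *
    f (A `&` \bigcap_(i in [set j | j \in lifts t]) E i)
  = f A - incl_excl f (codom (E \o lift ord0)) A.
  rewrite -IH; apply: eq_bigr => t _; rewrite card_imset; last exact: lift_inj.
  congr (_ * f (_ `&` _)); apply/seteqP; split=> x h i /= it.
    by apply: h; apply: imset_f.
  by case/imsetP: it => j jt ->; exact: h.
have -> : \sum_(t : {set 'I_k}) (-1) ^+ #|lifts0 t| *
    f (A `&` \bigcap_(i in [set j | j \in lifts0 t]) E i)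
  = - (f (A `&` E ord0) - incl_excl f (codom (E \o lift ord0)) (A `&` E ord0)).
  rewrite -IH -sumrN; apply: eq_bigr => t _.
  rewrite cardsU1 card_imset; last exact: lift_inj.
  have -> : (ord0 \notin lifts t) = true.
    by apply/imsetP => -[i _ /eqP]; rewrite (negbTE (neq_lift _ _)).
  rewrite add1n exprS mulN1r mulNr; congr (- (_ * f _)).
  rewrite -setIA; congr (_ `&` _); apply/seteqP; split=> x h.
    split=> [|i /= it]; apply: h => /=; first by rewrite finset.setU11.
    by rewrite finset.in_setU1 imset_f ?orbT.
  move=> i /=; rewrite finset.in_setU1 => /orP[/eqP->|/imsetP[j jt ->]]; first exact: h.1.
  exact: h.2.
lra.
Qed.

Lemma ie_preimage (T : Type) (g : T -> M) (f : set T -> int) s A :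
  incl_excl f [seq g @^-1` E | E <- s] (g @^-1` A)
  = incl_excl (fun A => f (g @^-1` A)) s A.
Proof. by elim: s A => [|E s IH] A //=; rewrite -preimage_setI !IH. Qed.

End DeltaInclExcl.

Section DeltaE.
Context (M : choiceType) (G : pregeometry M).
Local Open Scope ring_scope.

Lemma DeltaE k (E : 'I_k -> set M) :
  Delta G E = incl_excl (dimz G) (codom E) setT.
Proof.
have := signed_sum_ie (dimz G) E setT.
rewrite (bigD1 finset.set0) //= cards0 expr0 mul1r.
have -> : \bigcap_(i in [set j | j \in (finset.set0 : {set 'I_k})]) E i = setT.
  by apply/seteqP; split=> // x _ i /=; rewrite finset.in_set0.
rewrite setTI => /addrI; rewrite /Delta => h.
apply: oppr_inj; rewrite -h -sumrN; apply: eq_big => s; first by rewrite card_gt0.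
by move=> _; rewrite exprS mulN1r mulNr opprK setTI.
Qed.

Lemma codom_nth (s : seq (set M)) :
  codom (fun i : 'I_(size s) => nth set0 s i) = s.
Proof.
apply: (@eq_from_nth _ set0); first by rewrite size_codom card_ord.
move=> i; rewrite size_codom card_ord => lt; rewrite /codom /image_mem.
by rewrite (nth_map (Ordinal lt)) ?size_enum_ord // nth_enum_ord.
Qed.

Lemma fd_closed_family k (E : 'I_k -> set M) : fd_closed G E <-> fd_family G (codom E).
Proof.
split=> [h F /codomP[i ->]|h i]; first exact: h.
by apply: h; exact: codom_f.
Qed.

End DeltaE.

(** * Transport along rank-preserving maps *)

Definition dim_on (M : choiceType) (G : pregeometry M) (X A : set M) : int :=
  dimz G (A `&` X).

(** Strength of X inside Y expressed with closed sets of the ambient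
    pregeometry G only; Y is the full set for strength in G.  Unlike the
    version on subtypes it can be transported along any rank-preserving map. *)
Definition strong_over (M : choiceType) (G : pregeometry M) (X Y : set M) : Prop :=
  forall s, fd_family G s ->
    (incl_excl (dim_on G X) s setT <= incl_excl (dim_on G Y) s setT)%R.

Definition flat_on (M : choiceType) (G : pregeometry M) (Y : set M) : Prop :=
  forall s, fd_family G s ->
    (dim_on G Y (sunion s) <= incl_excl (dim_on G Y) s setT)%R.

Section RankMap.
Context (T M : choiceType) (H : pregeometry T) (G : pregeometry M) (g : T -> M).
Definition rank_map : Prop := forall A : {fset T}, rk G [fset g x | x in A]%fset = rk H A.
Hypothesis gP : rank_map.

Lemma image_fset (A : {fset T}) : [set` [fset g x | x in A]%fset] = g @` [set` A].
Proof.
apply/seteqP; split=> y /=; first by case/imfsetP=> x /= xA ->; exists x.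
by case=> x xA <-; apply/imfsetP; exists x.
Qed.

Lemma lift_fset (Y : set T) (B : {fset M}) : [set` B] `<=` g @` Y ->
  exists A : {fset T}, [/\ [set` A] `<=` Y, [fset g x | x in A]%fset = B &
     (#|` A| <= #|` B|)%N].
Proof.
move=> BY; have [->|[y0 y0B]] := fset_0Vmem B.
  by exists fset0; rewrite imfset0 cardfs0.
have [x0 Yx0 _] := BY y0 y0B.
pose h y := xget x0 [set x | Y x /\ g x = y].
have hP y : y \in B -> Y (h y) /\ g (h y) = y.
  by move=> /BY[x Yx gx]; apply: (@xgetPex _ x0 [set x | Y x /\ g x = y]); exists x.
exists [fset h y | y in B]%fset; split.
- by move=> x /= /imfsetP[y /= yB ->]; exact: (hP y yB).1.
- apply/fsetP => y; apply/imfsetP/idP => /= [[x /imfsetP[z /= zB ->] ->]|yB].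
    by rewrite (hP z zB).2.
  by exists (h y); [apply/imfsetP; exists y|rewrite (hP y yB).2].
- exact: leq_imfset_card.
Qed.

(** A rank-preserving map need not be injective, but it is injective on
    independent sets, and independent sets of the image lift. *)
Lemma rank_map_sizes (Y : set T) : indep_sizes H Y = indep_sizes G (g @` Y).
Proof.
apply/seteqP; split=> n.
  case=> A [iA AY ->]; exists [fset g x | x in A]%fset.
  have cA : #|` [fset g x | x in A]%fset| = #|` A|.
    apply/eqP; rewrite eqn_leq leq_imfset_card /=.
    by rewrite -iA -gP rk_card.
  split; rewrite ?cA //; first by rewrite /indep gP cA.
  by rewrite image_fset; exact: image_subset.
case=> B [iB /lift_fset[A [AY AB cA]] ->]; exists A.
have rA : rk H A = #|` B| by rewrite -gP AB.
have cAB : #|` A| = #|` B|.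
  by apply/eqP; rewrite eqn_leq cA -{1}rA rk_card.
by split; rewrite ?cAB // /indep rA.
Qed.

Lemma rank_map_fin_dim (Y : set T) : fin_dim H Y <-> fin_dim G (g @` Y).
Proof. by rewrite /fin_dim rank_map_sizes. Qed.

Lemma rank_map_edim (Y : set T) : edim H Y = edim G (g @` Y).
Proof. by rewrite /edim /fin_dim rank_map_sizes. Qed.

Lemma rank_map_dim (Y : set T) : dim H Y = dim G (g @` Y).
Proof. by rewrite /dim rank_map_edim. Qed.

Lemma rank_map_clf (A : {fset T}) x :
  clf H A x <-> clf G [fset g x | x in A]%fset (g x).
Proof. by rewrite /clf /= -!gP imfsetU imfset_fset1. Qed.

Lemma rank_map_cl (Y : set T) : cl H Y = g @^-1` (cl G (g @` Y)).
Proof.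
apply/seteqP; split=> x.
  case=> A [AY /rank_map_clf cA]; exists [fset g x | x in A]%fset; split=> //.
  by rewrite image_fset; exact: image_subset.
case=> B [/lift_fset[A [AY AB cA]] cB]; exists A; split=> //.
by apply/rank_map_clf; rewrite AB.
Qed.

Lemma rank_map_closed_pre (E : set M) : is_closed G E -> is_closed H (g @^-1` E).
Proof.
move=> cE; apply/seteqP; split; last exact: sub_cl.
rewrite rank_map_cl => x; apply: cl_min => //.
exact: image_preimage_subset.
Qed.

Lemma rank_map_closed (E : set T) : is_closed H E -> E = g @^-1` (cl G (g @` E)).
Proof. by move=> {1}<-; exact: rank_map_cl. Qed.

Lemma rank_map_fd_pre (s : seq (set M)) :
  fd_family G s -> fd_family H [seq g @^-1` E | E <- s].
Proof.
move=> fs _ /mapP[E /fs[cE fE] ->]; split; first exact: rank_map_closed_pre.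
apply/rank_map_fin_dim; apply: fin_dim_sub fE.
exact: image_preimage_subset.
Qed.

Lemma rank_map_fd (s : seq (set T)) : fd_family H s ->
  exists2 s', fd_family G s' & s = [seq g @^-1` E | E <- s'].
Proof.
move=> fs; exists [seq cl G (g @` E) | E <- s].
  move=> _ /mapP[E /fs[cE fE] ->]; split; first exact: closed_cl.
  by apply: fin_dim_cl; apply/rank_map_fin_dim.
rewrite -map_comp -[LHS]map_id; apply/eq_in_map => E /fs[cE _] /=.
exact: rank_map_closed.
Qed.

Lemma dim_on_pre (X : set T) (A : set M) :
  dim_on H X (g @^-1` A) = dim_on G (g @` X) A.
Proof.
rewrite /dim_on /dimz rank_map_dim; congr (dim _ _)%:Z%R.
apply/seteqP; split=> y; first by case=> x [Ax Xx] <-; split=> //; exists x.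
by case=> Ay [x Xx gx]; exists x => //; split; rewrite /preimage /= ?gx.
Qed.

Lemma ie_dim_on_pre (X : set T) s :
  incl_excl (dim_on H X) [seq g @^-1` E | E <- s] setT = incl_excl (dim_on G (g @` X)) s setT.
Proof.
rewrite -(preimage_setT g) ie_preimage; congr (incl_excl _ _ _).
by apply/funext => A; exact: dim_on_pre.
Qed.

Lemma rank_map_strong_over (X Y : set T) :
  strong_over H X Y <-> strong_over G (g @` X) (g @` Y).
Proof.
split=> [h s /rank_map_fd_pre/h|h s /rank_map_fd[s' fs' ->]].
  by rewrite !ie_dim_on_pre.
by rewrite !ie_dim_on_pre; exact: h.
Qed.

Lemma rank_map_flat_on (X : set T) : flat_on H X <-> flat_on G (g @` X).
Proof.
have e s : sunion [seq g @^-1` E | E <- s] = g @^-1` (sunion s).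
  apply/seteqP; split=> x; first by case=> E /mapP[F Fs ->] Fx; exists F.
  by case=> E Es Ex; exists (g @^-1` E) => //; exact: map_f.
split=> [h s /rank_map_fd_pre/h|h s /rank_map_fd[s' fs' ->]].
  by rewrite !ie_dim_on_pre e dim_on_pre.
by rewrite !ie_dim_on_pre e dim_on_pre; exact: h.
Qed.

End RankMap.

Section Ambient.
Context (M : choiceType) (G : pregeometry M).
Implicit Types (X Y : set M).

Lemma dim_onT : dim_on G setT = dimz G.
Proof. by apply/funext => A; rewrite /dim_on setIT. Qed.

Lemma restrict_rank_map X : rank_map (Defs.restrict G X) G val.
Proof. by move=> A. Qed.

Lemma val_image X (A : set M) : val @` [set x : X | A (val x)] = A `&` X.
Proof.
apply/seteqP; split=> x; first by case=> y Ay <-; split=> //; exact: set_valP.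
by case=> Ax Xx; exists (SigSub (mem_set Xx)).
Qed.

Lemma val_imageT X : range (val : X -> M) = X.
Proof.
apply/seteqP; split=> x; first by case=> y _ <-; exact: set_valP.
by move=> Xx; exists (SigSub (mem_set Xx)).
Qed.

Lemma flat_onP : flat G <-> flat_on G setT.
Proof.
split=> [h s fs|h k E fE].
  have := h _ (fun i : 'I_(size s) => nth set0 s i).
  rewrite DeltaE codom_nth dim_onT => le1; apply: le_trans (le1 _); last first.
    by apply/fd_closed_family; rewrite codom_nth.
  rewrite lez_nat; apply: dim_le; last first.
    suff -> : \bigcup_(i in [set: 'I_(size s)]) nth set0 s i = sunion s.
      exact: fin_dim_sunion.
    apply/seteqP; split=> x; first by case=> i _ Ex; exists (nth set0 s i) => //; exact: mem_nth.
    by case=> E /(nthP set0)[i lt <-] Ex; exists (Ordinal lt).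
  by move=> x [E /(nthP set0)[i lt <-] Ex]; exists (Ordinal lt).
have fE' : fd_family G (codom E) by apply/fd_closed_family.
have := h _ fE'; rewrite dim_onT DeltaE; apply: le_trans.
rewrite lez_nat; apply: dim_le; last exact: fin_dim_sunion.
by move=> x [i _ Ex]; exists (E i) => //; exact: codom_f.
Qed.

Lemma flat_familyP : flat G <-> flat_family G.
Proof. by rewrite flat_onP /flat_on dim_onT. Qed.

Lemma Delta_restrict X k (E : 'I_k -> set M) :
  Delta (Defs.restrict G X) (fun i => [set x : X | E i (val x)])
  = incl_excl (dim_on G X) (codom E) setT.
Proof.
rewrite DeltaE.
have -> : codom (fun i => [set x : X | E i (val x)])
    = [seq val @^-1` F | F <- codom E].
  by rewrite /codom /image_mem -map_comp.
have -> : dimz (Defs.restrict G X) = dim_on (Defs.restrict G X) setT.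
  by apply/funext => A; rewrite /dim_on setIT.
by rewrite (ie_dim_on_pre (@restrict_rank_map X)) val_imageT.
Qed.

Lemma strongP X : strong G X <-> strong_over G X setT.
Proof.
rewrite /strong_over dim_onT; split=> [h s fs|h k E fE].
  have := h _ (fun i : 'I_(size s) => nth set0 s i).
  rewrite (Delta_restrict X (fun i : 'I_(size s) => nth set0 s i)) DeltaE codom_nth.
  by apply; apply/fd_closed_family; rewrite codom_nth.
by rewrite Delta_restrict DeltaE; apply: h; exact/fd_closed_family.
Qed.

End Ambient.

Section AmbientRestrict.
Context (M : choiceType) (G : pregeometry M).
Implicit Types (X Y : set M).

Lemma flat_restrictP X : flat (Defs.restrict G X) <-> flat_on G X.
Proof.
by rewrite flat_onP (rank_map_flat_on (@restrict_rank_map M G X)) val_imageT.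
Qed.

Lemma strong_inP X Y : strong_in G X Y <-> strong_over G (X `&` Y) Y.
Proof.
by rewrite /strong_in strongP (rank_map_strong_over (@restrict_rank_map M G Y))
  val_image val_imageT.
Qed.

Lemma strong_starP X : strong_star G X <->
  forall A1 A2 : set M, A1 `<=` X -> A2 `<=` X ->
    edim G (cl G A1 `&` cl G A2 `&` X) = edim G (cl G A1 `&` cl G A2).
Proof.
have rm := @restrict_rank_map M G X.
split=> [h A1 A2 s1 s2|h X1 X2 c1 c2].
  have clr A : A `<=` X -> cl G (val @` [set x : X | cl G A (val x)]) = cl G A.
    move=> sA; rewrite val_image; apply/seteqP; split.
      by apply: cl_min; [exact: closed_cl|exact: subIsetl].
    by apply: cl_mono => x Ax; split; [exact: sub_cl|exact: sA].
  have cr A : is_closed (Defs.restrict G X) [set x : X | cl G A (val x)].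
    by apply: (rank_map_closed_pre rm); exact: closed_cl.
  have := h _ _ (cr A1) (cr A2); rewrite !clr // => <-.
  rewrite (rank_map_edim rm); congr edim.
  by apply/esym; exact: (val_image X (cl G A1 `&` cl G A2)).
have sub (Z : set X) : val @` Z `<=` X by move=> x [y _ <-]; exact: set_valP.
rewrite -(h _ _ (sub X1) (sub X2)) (rank_map_edim rm); congr edim.
rewrite -val_image; congr (val @` _).
by rewrite [in LHS](rank_map_closed rm c1) [in LHS](rank_map_closed rm c2).
Qed.

End AmbientRestrict.

(** * Strong finite sets *)

Section FiniteStrong.
Context (M : choiceType) (G : pregeometry M).
Implicit Types (X Y Z : {fset M}) (s : seq (set M)).

Lemma strong_fsetP Y : strong_fset G Y <-> strong G [set` Y].
Proof.
rewrite strongP /strong_over dim_onT /strong_fset.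
by split=> h s /h; rewrite ie_defect subr_ge0.
Qed.

Lemma fin_dim_subfset (A : set M) Y : A `<=` [set` Y] -> fin_dim G A.
Proof. by move=> /fin_dim_sub; apply; exact: fin_dim_fset. Qed.

(** Strength applied to the family of two closures. *)
Lemma strong_star_fset Y : strong G [set` Y] -> strong_star G [set` Y].
Proof.
move=> /strongP; rewrite /strong_over dim_onT => sY; apply/strong_starP => A1 A2 s1 s2.
have f1 := fin_dim_cl (fin_dim_subfset s1).
have f2 := fin_dim_cl (fin_dim_subfset s2).
have f12 : fin_dim G (cl G A1 `&` cl G A2) by exact: fin_dim_sub (@subIsetl _ _ _) f1.
have f12Y : fin_dim G (cl G A1 `&` cl G A2 `&` [set` Y]).
  exact: fin_dim_sub (@subIsetl _ _ _) f12.
rewrite !edim_fin //; congr Some; apply/eqP.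
rewrite eqn_leq (dim_le (@subIsetl _ _ _) f12) /=.
have := sY [:: cl G A1; cl G A2].
have h (A : set M) : A `<=` [set` Y] -> dim G (cl G A `&` [set` Y]) = dim G (cl G A).
  move=> sA; have fA := fin_dim_cl (fin_dim_subfset sA).
  apply/eqP; rewrite eqn_leq (dim_le (@subIsetl _ _ _) fA) /=.
  rewrite dim_cl ?(fin_dim_subfset sA) //; last exact: (fin_dim_subfset sA).
  apply: dim_le; last exact: fin_dim_sub (@subIsetl _ _ _) fA.
  by move=> x Ax; split; [exact: sub_cl|exact: sA].
rewrite /= !setTI /dim_on /dimz !h // => h'.
have fA : fd_family G [:: cl G A1; cl G A2].
  by move=> E; rewrite !inE => /orP[] /eqP->; split => //; exact: closed_cl.
by rewrite -lez_nat; have := h' fA; lia.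
Qed.

(** When strong_star holds for Y, the sets spanned by their trace on Y are
    stable under intersection (capturedI), so that alternating sums over them
    can be computed inside Y (star_ie). *)
Definition captured Y (E : set M) : Prop := fin_dim G E /\ hull G Y E = E.

Lemma captured_closed Y E : captured Y E -> is_closed G E.
Proof. by move=> [_ <-]; exact: closed_cl. Qed.

Lemma captured_hull Y E : fd_flat G E -> captured Y (hull G Y E).
Proof.
move=> fE; split; first exact: (fd_flat_hull Y fE).2.
by rewrite {1}/hull hull_trace //; exact: fE.1.
Qed.

Lemma captured_dim Y E : captured Y E -> dim_onf G Y E = dimz G E.
Proof.
by move=> [fE {2}<-]; rewrite /dim_onf /dimz dim_cl //; exact: fin_dimIY.
Qed.

Lemma capturedI Y E F : strong_star G [set` Y] ->
  captured Y E -> captured Y F -> captured Y (E `&` F).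
Proof.
move=> /strong_starP st cE cF.
have fEF : fin_dim G (E `&` F) by exact: fin_dim_sub (@subIsetl _ _ _) cE.1.
split=> //; have clEF := closedI (captured_closed cE) (captured_closed cF).
apply/seteqP; split; first exact: hull_sub.
apply: dim_eq_sub => //.
have := st (E `&` [set` Y]) (F `&` [set` Y]) (@subIsetr _ _ _) (@subIsetr _ _ _).
have -> : cl G (E `&` [set` Y]) = E by exact: cE.2.
have -> : cl G (F `&` [set` Y]) = F by exact: cF.2.
rewrite !edim_fin //; last exact: fin_dimIY.
by case=> ->.
Qed.

Lemma star_ie Y s : strong_star G [set` Y] ->
  {in s, forall E, captured Y E} ->
  incl_excl (dimz G) s setT = incl_excl (dim_onf G Y) s setT.
Proof.
move=> st; have : forall E, captured Y E -> captured Y (setT `&` E).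
  by move=> E; rewrite setTI.
move: setT; elim: s => [|E s IH] //= A cA cs.
have cs' : {in s, forall E, captured Y E} by move=> F Fs; apply: cs; rewrite inE Fs orbT.
have cE := cA _ (cs _ (mem_head _ _)).
rewrite captured_dim // !IH // => F cF.
exact: capturedI.
Qed.

Lemma ie_bases s (A : set M) : fd_family G s -> exists B,
  forall Y, (B `<=` Y)%fset -> incl_excl (dimz G) s A = incl_excl (dim_onf G Y) s A.
Proof.
elim: s A => [|E s IH] A fs /=; first by exists fset0.
have fs' : fd_family G s by move=> F Fs; apply: fs; rewrite inE Fs orbT.
have [B1 h1] := IH A fs'; have [B2 h2] := IH (A `&` E) fs'.
have fAE : fin_dim G (A `&` E).
  by apply: fin_dim_sub (fs E (mem_head _ _)).2; exact: subIsetr.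
have [B3 sB] := fin_dim_spans fAE.
exists (B3 `|` (B1 `|` B2))%fset => Y; rewrite !fsubUset => /and3P[s3 s1 s2].
rewrite (h1 Y) // (h2 Y) //; congr (_ + _ - _)%R.
rewrite /dim_onf /dimz; congr (_%:Z)%R; apply/eqP.
rewrite eqn_leq (dim_le (@subIsetl _ _ _) fAE) andbT (spans_dim sB).2 -dim_fset.
apply: dim_le; last exact: fin_dimIY.
by move=> x xB; split; [exact: sB.1|exact: (fsubsetP s3)].
Qed.

(** A family of flats has the same traces on Y, hence on X, as the family of
    its hulls, and for the latter the sums in Y and in G agree. *)
Lemma strong_over_star X Y : (X `<=` Y)%fset -> strong G [set` X] ->
  strong_star G [set` Y] -> strong_over G [set` X] [set` Y].
Proof.
move=> XY /strongP; rewrite /strong_over dim_onT => sX st s fs.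
have h1 : {in s, forall E, hull G Y E `&` [set` Y] = E `&` [set` Y]}.
  by move=> E /fs[cE _]; exact: hull_trace.
rewrite -[leRHS](@ie_dim_onf_map _ G Y _ s h1) -star_ie //; last first.
  by move=> _ /mapP[E /fs fE ->]; exact: captured_hull.
rewrite -[leLHS](@ie_dim_onf_map _ G X (hull G Y) s); last first.
  move=> E /h1 e; have -> : [set` X] = [set` Y] `&` [set` X].
    by rewrite setIidr // => x; exact: (fsubsetP XY).
  by rewrite !setIA e.
apply: sX => _ /mapP[E /fs fE ->]; exact: fd_flat_hull.
Qed.

Lemma flat_on_star Y : flat G -> strong_star G [set` Y] -> flat_on G [set` Y].
Proof.
move=> /flat_familyP fG st s fs.
have h1 : {in s, forall E, hull G Y E `&` [set` Y] = E `&` [set` Y]}.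
  by move=> E /fs[cE _]; exact: hull_trace.
rewrite -[leRHS](@ie_dim_onf_map _ G Y _ s h1) -star_ie //; last first.
  by move=> _ /mapP[E /fs fE ->]; exact: captured_hull.
have fs' : fd_family G (map (hull G Y) s).
  by move=> _ /mapP[E /fs fE ->]; exact: fd_flat_hull.
apply: le_trans (fG _ fs'); rewrite lez_nat; apply: dim_le.
  exact: sunion_hull.
exact: fin_dim_sunion.
Qed.

(** Given a family violating strength, a finite strong superset Y of X
    containing bases of all its intersections already sees the violation. *)
Lemma nstrong_strong X : flat G -> (forall n, nstrong G n [set` X]) ->
  strong G [set` X].
Proof.
move=> fG nX; apply/strongP => s fs; rewrite dim_onT.
have [B hB] := ie_bases setT fs.
have [Y [XBY /strong_fsetP sY]] := exists_strong ((flat_familyP G).1 fG) (X `|` B)%fset.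
move: XBY; rewrite fsubUset => /andP[XY BY]; rewrite (hB Y BY).
have sXY : [set` X] `<=` [set` Y] by exact/fsubsetP.
have := (nX #|` Y|).2 [set` Y] sXY (strong_star_fset sY) _.
rewrite strong_inP (setIidl sXY) => h; apply: h => //.
apply: card_le_trans (subset_card_le (@subDsetl _ _ _)) _.
have e : ([set` Y] #= `I_#|` Y|)%card by apply/card_eq_fsetP.
by rewrite (card_le_eql e).
Qed.

End FiniteStrong.

(** * Definable properties of finite tuples *)

Lemma rename_formula k (phi : formula k) l (f : 'I_k -> 'I_l) :
  exists psi : formula l, forall (S : Lstruct) (v : 'I_l -> S),
    sat psi v <-> sat phi (v \o f).
Proof.
elim: k / phi l f => [k|k i j|k n t|k p1 IH1 p2 IH2|k p IH] l f.
- by exists (Fbot l) => S v; split.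
- by exists (Feq (f i) (f j)) => S v; split.
- exists (FI (map_tuple f t)) => S v /=.
  suff -> : map_tuple v (map_tuple f t) = map_tuple (v \o f) t by [].
  by apply: val_inj; rewrite /= -map_comp.
- have [q1 h1] := IH1 l f; have [q2 h2] := IH2 l f.
  by exists (Fimp q1 q2) => S v /=; move: (h1 S v) (h2 S v); tauto.
- have [q h] := IH l.+1 (fun i => if unlift ord0 i is Some j then lift ord0 (f j) else ord0).
  exists (Fall q) => S v /=.
  have e x : vcons x v \o (fun i => if unlift ord0 i is Some j then lift ord0 (f j) else ord0)
     = vcons x (v \o f).
    apply/funext => i /=; rewrite /vcons; case: (unliftP ord0 i) => [j|] _ /=.
      by rewrite liftK.
    by rewrite unlift_none.
  by split=> hx x; have := hx x; rewrite h e.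
Qed.

(** Through this map a formula in #|X| variables is read as a formula with
    variables in X. *)
Definition var_of (X : finType) (i : 'I_#|X|) : X := enum_val i.

Lemma var_ofK (X : finType) (x : X) : var_of (enum_rank x) = x.
Proof. exact: enum_rankK. Qed.

(** Properties are considered on structures carrying extra data K, such as an
    interpreted pregeometry.  Indexing variables by a finite type instead of an
    ordinal turns blocks of quantifiers into sums of index types. *)
Section Definable.
Variable K : Lstruct -> Type.
Implicit Types (X Y : finType).

Definition prop_on X : Type := forall S : Lstruct, K S -> (X -> S) -> Prop.

Definition definable X (P : prop_on X) : Prop :=
  exists phi : formula #|X|, forall (S : Lstruct) (g : K S) (v : X -> S),
    sat phi (v \o @var_of _) <-> P S g v.

Lemma def_ext X (P Q : prop_on X) : (forall S g v, P S g v <-> Q S g v) ->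
  definable P -> definable Q.
Proof. by move=> e [p h]; exists p => S g v; rewrite h. Qed.

Lemma def_imp X (P Q : prop_on X) : definable P -> definable Q ->
  definable (fun S g v => P S g v -> Q S g v).
Proof. by move=> [p hp] [q hq]; exists (Fimp p q) => S g v /=; move: (hp S g v) (hq S g v); tauto. Qed.

Lemma def_const X (A : Prop) : definable (fun S g (v : X -> S) => A).
Proof.
have dF : definable (fun S g (v : X -> S) => False) by exists (Fbot _) => S g v; split.
have [a|na] := pselect A.
  by apply: def_ext (def_imp dF dF) => S g v; split.
by apply: def_ext dF => S g v; split.
Qed.

Lemma def_not X (P : prop_on X) : definable P -> definable (fun S g v => ~ P S g v).
Proof. by move=> dP; apply: (def_imp dP); exact: def_const. Qed.

Lemma def_and X (P Q : prop_on X) : definable P -> definable Q ->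
  definable (fun S g v => P S g v /\ Q S g v).
Proof.
move=> dP dQ; apply: def_ext (def_not (def_imp dP (def_not dQ))) => S g v.
split=> [h|[p q] h]; last exact: (h p q).
by split; apply: contrapT => n; apply: h.
Qed.

Lemma def_all X (I : finType) (P : I -> prop_on X) : (forall i, definable (P i)) ->
  definable (fun S g v => forall i, P i S g v).
Proof.
move=> dP.
have : definable (fun S g v => forall i, i \in enum I -> P i S g v).
  elim: (enum I) => [|i s IH].
    by apply: def_ext (@def_const _ True) => S g v; split.
  apply: def_ext (def_and (dP i) IH) => S g v; split=> [[h1 h2] j|h].
    by rewrite inE => /orP[/eqP->//|/h2].
  by split=> [|j js]; apply: h; rewrite inE ?eqxx ?js ?orbT.
apply: def_ext => S g v; split=> h i *; apply: h.
by rewrite mem_enum.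
Qed.

Lemma def_ex X (I : finType) (P : I -> prop_on X) : (forall i, definable (P i)) ->
  definable (fun S g v => exists i, P i S g v).
Proof.
move=> dP; have dn i := def_not (dP i).
apply: def_ext (def_not (def_all dn)) => S g v; split.
  by move=> /existsNP[i /contrapT]; exists i.
by move=> [i p] h; exact: (h i).
Qed.

Lemma def_eq X (x y : X) : definable (fun S g v => v x = v y).
Proof.
by exists (Feq (enum_rank x) (enum_rank y)) => S g v /=; rewrite !var_ofK.
Qed.

Lemma def_rel X n (t : n.-tuple X) : definable (fun S g v => relI (map_tuple v t)).
Proof.
exists (FI (map_tuple enum_rank t)) => S g v /=.
suff -> : map_tuple (v \o @var_of _) (map_tuple enum_rank t) = map_tuple v t by [].
by apply: val_inj; rewrite /= -map_comp; apply: eq_map => x /=; rewrite var_ofK.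
Qed.

Lemma def_ren X Y (f : X -> Y) (P : prop_on X) : definable P ->
  definable (fun S g (v : Y -> S) => P S g (v \o f)).
Proof.
move=> [p h].
have [q hq] := rename_formula p (enum_rank \o f \o @var_of _).
exists q => S g v; rewrite hq -h.
have -> // : v \o @var_of _ \o (enum_rank \o f \o @var_of _) = v \o f \o @var_of _.
by apply/funext => i /=; rewrite var_ofK.
Qed.

Lemma def_forall1 X (P : prop_on (option X)) : definable P ->
  definable (fun S g (v : X -> S) => forall x, P S g (oapp v x)).
Proof.
move=> [p h].
have [q hq] := rename_formula p (fun i : 'I_#|{: option X}| =>
  if var_of i is Some x then lift ord0 (enum_rank x) else ord0 : 'I_#|X|.+1).
exists (Fall q) => S g v /=.
have e x : vcons x (v \o @var_of _) \o (fun i : 'I_#|{: option X}| =>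
    if var_of i is Some x then lift ord0 (enum_rank x) else ord0 : 'I_#|X|.+1)
    = oapp v x \o @var_of _.
  apply/funext => i /=; rewrite /vcons; case: (var_of i) => [y|] /=.
    by rewrite liftK /= var_ofK.
  by rewrite unlift_none.
by split=> hx x; have := hx x; rewrite hq -h e.
Qed.

Definition sum_val (X Y A : Type) (v : X -> A) (w : Y -> A) (z : X + Y) : A :=
  match z with inl x => v x | inr y => w y end.

Lemma def_forall_ord X n (P : prop_on (X + 'I_n)%type) : definable P ->
  definable (fun S g (v : X -> S) => forall w : 'I_n -> S, P S g (sum_val v w)).
Proof.
elim: n X P => [|n IH] X P dP.
  pose f (z : X + 'I_0) : X := match z with inl x => x | inr i => no_var X i end.
  have := def_ren f dP; apply: def_ext => S g v; split=> [h w|h].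
    by suff -> : sum_val v w = v \o f by []; apply/funext => -[x|[]].
  suff -> : v \o f = sum_val v (@no_var S) by exact: h.
  by apply/funext => -[x|[]].
pose f (z : X + 'I_n.+1) : option X + 'I_n :=
  match z with inl x => inl (Some x) | inr i => if unlift ord0 i is Some j then inr j else inl None end.
have := def_forall1 (IH _ _ (def_ren f dP)); apply: def_ext => S g v.
have e x (w : 'I_n -> S) : sum_val (oapp v x) w \o f = sum_val v (vcons x w).
  by apply/funext => -[y|i] //=; rewrite /vcons; case: (unlift ord0 i).
split=> [h w|h x w]; last by rewrite e; exact: h.
have := h (w ord0) (w \o lift ord0); rewrite e.
suff -> : vcons (w ord0) (w \o lift ord0) = w by [].
by apply/funext => i; rewrite /vcons; case: (unliftP ord0 i) => [j|] ->.
Qed.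

Lemma def_forall X Y (P : prop_on (X + Y)%type) : definable P ->
  definable (fun S g (v : X -> S) => forall w : Y -> S, P S g (sum_val v w)).
Proof.
move=> dP; pose f (z : X + Y) : X + 'I_#|Y| :=
  match z with inl x => inl x | inr y => inr (enum_rank y) end.
have := def_forall_ord (def_ren f dP); apply: def_ext => S g v.
split=> h w.
  have := h (w \o @var_of _).
  suff -> : sum_val v (w \o @var_of _) \o f = sum_val v w by [].
  by apply/funext => -[x|y] //=; rewrite var_ofK.
suff -> : sum_val v w \o f = sum_val v (w \o enum_rank) by exact: h.
by apply/funext => -[].
Qed.

Lemma def_exists X Y (P : prop_on (X + Y)%type) : definable P ->
  definable (fun S g (v : X -> S) => exists w : Y -> S, P S g (sum_val v w)).
Proof.
move=> dP; apply: def_ext (def_not (def_forall (def_not dP))) => S g v; split.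
  by move=> /existsNP[w /contrapT]; exists w.
by move=> [w p] h; exact: (h w).
Qed.

(** Finitely many such functions take finitely many values in total, so any
    relation between their values is definable (def_nat_rel). *)
Definition nat_definable X (f : forall S, K S -> (X -> S) -> nat) : Prop :=
  (exists N, forall S g v, (f S g v <= N)%N) /\
  forall n, definable (fun S g v => (n <= f S g v)%N).

Lemma def_nat_eq X f n : @nat_definable X f -> definable (fun S g v => f S g v = n).
Proof.
move=> [_ h]; apply: def_ext (def_and (h n) (def_not (h n.+1))) => S g v.
split=> [[h1 /negP h2]|->]; last by rewrite leqnn ltnn.
by apply/eqP; rewrite eqn_leq h1 andbT leqNgt.
Qed.

Lemma def_nat_rel X (I : finType) (f : I -> forall S, K S -> (X -> S) -> nat)
    (R : (I -> nat) -> Prop) :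
  (forall i, nat_definable (f i)) -> definable (fun S g v => R (fun i => f i S g v)).
Proof.
move=> df.
have [N hN] : exists N, forall i S g v, (f i S g v <= N)%N.
  have /choice[B hB] : forall i, exists N, forall S g v, (f i S g v <= N)%N.
    by move=> i; exact: (df i).1.
  exists (\max_i B i) => i S g v; apply: leq_trans (hB i S g v) _.
  exact: leq_bigmax.
have d (r : {ffun I -> 'I_N.+1}) : definable (fun S g (v : X -> S) =>
    (forall i, f i S g v = r i) /\ R (fun i => r i : nat)).
  apply: def_and; last exact: def_const.
  by apply: def_all => i; exact: def_nat_eq (df i).
apply: def_ext (def_ex d) => S g v; split=> [[r [h Rr]]|Rf].
  by suff -> : (fun i => f i S g v) = (fun i => r i : nat) by []; apply/funext.
exists [ffun i => inord (f i S g v)].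
have e i : f i S g v = [ffun i => inord (f i S g v) : 'I_N.+1] i.
  by rewrite ffunE inordK // ltnS.
split=> //; suff -> : (fun i => ([ffun i => inord (f i S g v) : 'I_N.+1] i) : nat)
   = (fun i => f i S g v) by [].
by apply/funext => i; rewrite -e.
Qed.

End Definable.

(** * Induced pregeometries and ranks read off the relations *)

Section Pull.
Context (M N : choiceType) (G : pregeometry M) (v : N -> M).

Definition pull_rk (A : {fset N}) : nat := rk G [fset v x | x in A]%fset.

Lemma pull_rk0 : pull_rk fset0 = 0%N.
Proof. by rewrite /pull_rk imfset0 rk0. Qed.

Lemma pull_rk_incr (A : {fset N}) (x : N) :
  (pull_rk A <= pull_rk (A `|` [fset x])%fset)%N /\
  (pull_rk (A `|` [fset x])%fset <= (pull_rk A).+1)%N.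
Proof. by rewrite /pull_rk imfsetU imfset_fset1; exact: rk_incr. Qed.

Lemma pull_rk_submod (A B : {fset N}) :
  (pull_rk (A `|` B)%fset + pull_rk (A `&` B)%fset <= pull_rk A + pull_rk B)%N.
Proof.
apply: leq_trans (rk_submod G _ _); rewrite /pull_rk imfsetU leq_add2l.
apply: rk_mono; rewrite fsubsetI; apply/andP; split; apply/fsubsetP => y.
  by case/imfsetP => x /=; rewrite in_fsetI => /andP[xA xB] ->; apply/imfsetP; exists x.
by case/imfsetP => x /=; rewrite in_fsetI => /andP[xA xB] ->; apply/imfsetP; exists x.
Qed.

Definition pull : pregeometry N := Pregeometry pull_rk0 pull_rk_incr pull_rk_submod.

Lemma pull_rank_map : rank_map pull G v. Proof. by []. Qed.
End Pull.

Lemma pregeometry_eq (M : choiceType) (G H : pregeometry M) :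
  (forall A, rk G A = rk H A) -> G = H.
Proof.
case: G H => r1 a1 b1 c1 [r2 a2 b2 c2] /= /funext e; subst r2.
by congr Pregeometry; exact: Prop_irrelevance.
Qed.

Lemma rank_map_pull (T M : choiceType) (H : pregeometry T) (G : pregeometry M) g :
  rank_map H G g <-> pull G g = H.
Proof.
split=> [h|<-]; last exact: pull_rank_map.
by apply: pregeometry_eq => A; exact: h.
Qed.

Section StructRank.
Variable S : Lstruct.

Definition free_tuple (A : {fset S}) n (t : n.-tuple S) : Prop :=
  [/\ {subset t <= A}, uniq t & relI t].

(** The rank of a finite set in an arbitrary structure, read off its
    relations; it is the rank function of any pregeometry interpreted by the
    structure. *)
Definition rkS (A : {fset S}) : nat :=
  \max_(i < #|` A|.+1 | `[< exists t : i.-tuple S, free_tuple A t >]) i.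

Lemma rkS_ge A n (t : n.-tuple S) : free_tuple A t -> (n <= rkS A)%N.
Proof.
move=> ft; have [tA ut _] := ft.
have nA : (n < #|` A|.+1)%N.
  by rewrite ltnS -(size_tuple t); exact: uniq_leq_size.
apply: (@leq_bigmax_cond _ (fun i : 'I_#|` A|.+1 =>
  `[< exists t : i.-tuple S, free_tuple A t >]) (fun i => i : nat) (Ordinal nA)).
by apply/asboolP; exists t.
Qed.

Lemma rkS_ex A : rkS A = 0%N \/ exists t : (rkS A).-tuple S, free_tuple A t.
Proof.
rewrite /rkS; elim/big_ind: _ => [|x y hx hy|i /asboolP]; first by left.
  by rewrite /maxn; case: ifP.
by right.
Qed.

Lemma rkS_card A : (rkS A <= #|` A|)%N.
Proof. by apply/bigmax_leqP => i _; rewrite -ltnS. Qed.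

Lemma rkS_rk (G : pregeometry S) A : interprets G -> rkS A = rk G A.
Proof.
move=> iG; apply/eqP; rewrite eqn_leq; apply/andP; split.
  have [->//|[t [tA ut rt]]] := rkS_ex A.
  have [_ it] := (iG _ t).1 rt.
  have e : #|` [fset x in tval t]%fset| = rkS A.
    by rewrite card_fseq undup_id // size_tuple.
  rewrite -{1}e -it; apply: rk_mono; apply/fsubsetP => x.
  by rewrite inE /= => /tA.
have [B iB sB] := fin_dim_basis (fin_dim_fset G A).
rewrite -dim_fset (spans_dim sB).2 iB.
apply: (rkS_ge (t := in_tuple (enum_fset B))); split.
- by move=> x; exact: sB.1.
- exact: fset_uniq.
apply/iG; split; first exact: fset_uniq.
have -> // : [fset x in tval (in_tuple (enum_fset B))]%fset = B.
by apply/fsetP => x; rewrite !inE.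
Qed.

Lemma interprets_uniq (G H : pregeometry S) : interprets G -> interprets H -> G = H.
Proof. by move=> iG iH; apply: pregeometry_eq => A; rewrite -!rkS_rk. Qed.
End StructRank.

Section RankDefinable.
Variable K : Lstruct -> Type.
Implicit Types X : finType.

Definition fset_of X (A : {set X}) : {fset X} := [fset x in A]%fset.
Definition img X (M : choiceType) (v : X -> M) (A : {set X}) : {fset M} :=
  [fset v x | x in fset_of A]%fset.

Lemma in_fset_of X (A : {set X}) x : (x \in fset_of A) = (x \in A).
Proof. by rewrite /fset_of !inE. Qed.

Lemma card_fset_of X (A : {set X}) : #|` fset_of A| = #|A|.
Proof. by rewrite /fset_of card_imfset //= -cardE. Qed.

Lemma imgP X (M : choiceType) (v : X -> M) (A : {set X}) y :
  reflect (exists2 x, x \in A & y = v x) (y \in img v A).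
Proof.
apply: (iffP (imfsetP _ _ _ _)) => -[x /= xA ->]; exists x => //.
  by rewrite -in_fset_of.
by rewrite in_fset_of.
Qed.

Lemma card_img X (M : choiceType) (v : X -> M) (A : {set X}) : (#|` img v A| <= #|X|)%N.
Proof.
apply: leq_trans (leq_imfset_card _ _ _) _ => /=.
rewrite -[size _]/(#|` fset_of A|) -(size_map id) map_id cardE.
by apply: uniq_leq_size => [|x _]; rewrite ?fset_uniq ?mem_enum.
Qed.

Lemma imgU (X : finType) (M : choiceType) (v : X -> M) (A B : {set X}) :
  img v (A :|: B)%SET = (img v A `|` img v B)%fset.
Proof.
apply/fsetP => y; rewrite in_fsetU; apply/imgP/orP => [[x]|].
  by rewrite finset.in_setU => /orP[xA|xB] ->; [left|right]; apply/imgP; exists x.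
by case=> /imgP[x xA ->]; exists x => //; rewrite finset.in_setU xA ?orbT.
Qed.

Lemma img_sub (X : finType) (M : choiceType) (v : X -> M) (A B : {set X}) :
  A \subset B -> (img v A `<=` img v B)%fset.
Proof.
move=> /fintype.subsetP sAB; apply/fsubsetP => y /imgP[x /sAB xB ->].
by apply/imgP; exists x.
Qed.

Lemma fset_as_img (M : choiceType) (C : {fset M}) : exists (k : nat) (v : 'I_k -> M),
  injective v /\ forall A : {fset M}, (A `<=` C)%fset -> exists I : {set 'I_k}, A = img v I.
Proof.
exists #|` C|, (fun i => tnth (in_tuple (enum_fset C)) i); split.
  by apply/tuple_uniqP; exact: fset_uniq.
move=> A /fsubsetP AC; exists [set i | tnth (in_tuple (enum_fset C)) i \in A]%SET.
apply/fsetP => x; apply/idP/imgP => [xA|[i]]; last by rewrite inE => xA ->.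
have /tnthP[i e] : x \in in_tuple (enum_fset C) by exact: AC.
by exists i; rewrite ?inE -?e.
Qed.

Lemma imgI (X : finType) (M : choiceType) (v : X -> M) (A B : {set X}) : injective v ->
  img v (A :&: B)%SET = (img v A `&` img v B)%fset.
Proof.
move=> iv; apply/fsetP => y; rewrite in_fsetI; apply/imgP/andP => [[x]|].
  by rewrite finset.in_setI => /andP[xA xB] ->; split; apply/imgP; exists x.
by case=> /imgP[x xA ->] /imgP[z zB /iv e]; exists x => //; rewrite finset.in_setI xA e.
Qed.

Lemma img_tuple (X : finType) (M : choiceType) (v : X -> M) n (t : n.-tuple X) :
  img v [set x in t]%SET = [fset y in tval (map_tuple v t)]%fset.
Proof.
apply/fsetP => y; rewrite inE; apply/imgP/mapP => -[x xt ->]; exists x => //.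
  by rewrite inE in xt.
by rewrite inE.
Qed.

Lemma card_fset_tuple (M : choiceType) n (t : n.-tuple M) :
  uniq t -> #|` [fset x in tval t]%fset| = n.
Proof. by move=> ut; rewrite card_fseq undup_id // size_tuple. Qed.

Lemma def_uniq X n (t : n.-tuple X) :
  definable (fun S (g : K S) v => uniq (map v t)).
Proof.
have d (p : 'I_n * 'I_n) : definable (fun S (g : K S) (v : X -> S) =>
    p.1 <> p.2 -> v (tnth t p.1) <> v (tnth t p.2)).
  by apply: def_imp; [exact: def_const|apply: def_not; exact: def_eq].
apply: def_ext (def_all d) => S g v; split=> [h|u [i j] /= nij e].
  apply/(tuple_uniqP (map_tuple v t)) => i j; rewrite !tnth_map => e.
  by apply: contrapT => nij; apply: (h (i, j)).
apply: nij; have /tuple_uniqP := u : uniq (map_tuple v t).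
by apply; rewrite !tnth_map.
Qed.

Lemma nat_def_rkS X (A : {set X}) :
  nat_definable (fun S (g : K S) (v : X -> S) => rkS (img v A)).
Proof.
split; first by exists #|X| => S g v; apply: leq_trans (rkS_card _) (card_img _ _).
case=> [|n]; first by apply: def_ext (@def_const _ _ True) => S g v; split.
have d (m : 'I_#|X|.+1) : definable (fun S (g : K S) (v : X -> S) =>
   exists t : m.-tuple X, [/\ (n < m)%N, {subset t <= A}, uniq (map v t) & relI (map_tuple v t)]).
  apply: def_ex => t.
  apply: def_ext (def_and (@def_const K _ ((n < m)%N /\ {subset t <= A}))
    (def_and (def_uniq t) (def_rel _ t))) => S g v.
  by split=> [[[? ?] [? ?]]|[]].
apply: def_ext (def_ex d) => S g v; split.
  move=> [m [t [nm tA ut rt]]]; apply: leq_trans nm _.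
  apply: (rkS_ge (t := map_tuple v t)); split=> //.
  by move=> _ /mapP[x /tA xA ->]; apply/imgP; exists x.
move=> nr; have [r0|[t [tA ut rt]]] := rkS_ex (img v A); first by rewrite r0 in nr.
have lt : (rkS (img v A) < #|X|.+1)%N.
  by rewrite ltnS; apply: leq_trans (rkS_card _) (card_img _ _).
have [x0 x0A] : exists x, x \in A.
  have /imgP[x xA _] : tnth t (Ordinal nr) \in img v A by apply: tA; exact: mem_tnth.
  by exists x.
pose h y := if [pick x in A | v x == y] is Some x then x else x0.
have hP y : y \in img v A -> h y \in A /\ v (h y) = y.
  case/imgP => x xA ->; rewrite /h; case: pickP => [z /andP[zA /eqP ez]|/(_ x)] //.
  by rewrite xA eqxx.
have e : map v (map_tuple h t) = t.
  by rewrite /= -map_comp -[RHS]map_id; apply/eq_in_map => y /tA/hP[_].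
exists (Ordinal lt), (map_tuple h t); split=> //.
- by move=> _ /mapP[y /tA/hP[yA _] ->].
- by rewrite e.
- by rewrite (_ : map_tuple v (map_tuple h t) = t) //; apply: val_inj.
Qed.

End RankDefinable.

(** * The interpreted pregeometry of a model *)

Section Transfer.
Variable tau : nat -> nat.

Lemma def_closed (K : Lstruct -> Type) (X : finType) (D : prop_on K X) : definable D ->
  exists phi : sentence, forall S (g : K S), holds S phi <-> forall w : X -> S, D S g w.
Proof.
move=> dD; pose E : prop_on K void := fun S g _ => forall w : X -> S, D S g w.
have [p hp] : definable E.
  have := def_forall (def_ren (fun x : X => (inr x : void + X)) dD).
  apply: def_ext => S g v; split=> h w; have := h w.
    by suff -> : sum_val v w \o (fun x : X => (inr x : void + X)) = w by [].
  by suff -> : sum_val v w \o (fun x : X => (inr x : void + X)) = w by [].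
have [q hq] := rename_formula p (fun i : 'I_#|{: void}| =>
  match var_of i return 'I_0 with end).
exists q => S g; have := hp S g (fun x : void => match x with end).
rewrite /E => <-; rewrite /holds hq.
by split; congr sat; apply/funext => i; case: (var_of i).
Qed.

Lemma transfer (K : Lstruct -> Type) (X : finType) (D : prop_on K X) S :
  models S (T_ tau) -> definable D ->
  (forall S', T_axioms tau S' -> exists g : K S', True) ->
  (forall S', T_axioms tau S' -> forall (g : K S') w, D S' g w) ->
  forall (g : K S) w, D S g w.
Proof.
move=> mS /def_closed[phi hphi] inh h g; apply/hphi; apply: mS => S' TS'.
by have [g' _] := inh S' TS'; apply/(hphi S' g') => w; exact: h.
Qed.
End Transfer.

Section Existence.
Variables (tau : nat -> nat) (S : Lstruct).
Hypothesis mS : models S (T_ tau).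

Let K0 (S : Lstruct) : Type := unit.
Let inh0 S' : T_axioms tau S' -> exists g : K0 S', True.
Proof. by exists tt. Qed.

(** Relations between finitely many ranks that hold in all pregeometries hold
    for rkS in models of the theory; this yields the pregeometry axioms. *)
Lemma transfer_rank (X : finType) (I : finType) (A : I -> {set X}) (R : (I -> nat) -> Prop) :
  (forall (M : choiceType) (G : pregeometry M) (v : X -> M), R (fun i => rk G (img v (A i)))) ->
  forall v : X -> S, R (fun i => rkS (img v (A i))).
Proof.
move=> h v.
have d : definable (fun S (g : K0 S) (v : X -> S) => R (fun i => rkS (img v (A i)))).
  by apply: (def_nat_rel (K := K0) (f := fun i S g v => rkS (img v (A i)))) => i; exact: nat_def_rkS.
apply: (transfer mS d inh0 _ tt) => S' [G [iG _ _ _]] _ w.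
have -> : (fun i => rkS (img w (A i))) = (fun i => rk G (img w (A i))); last exact: h.
by apply/funext => i; rewrite (rkS_rk _ iG).
Qed.

Lemma rkS_mono (A B : {fset S}) : (A `<=` B)%fset -> (rkS A <= rkS B)%N.
Proof.
move=> sAB; have [->//|[t [tA ut rt]]] := rkS_ex A.
by apply: (rkS_ge (t := t)); split=> // x /tA; exact: (fsubsetP sAB).
Qed.

Lemma rkS_incr (A : {fset S}) x : (rkS A <= rkS (A `|` [fset x])%fset)%N /\
  (rkS (A `|` [fset x])%fset <= (rkS A).+1)%N.
Proof.
split; first by apply: rkS_mono; exact: fsubsetUl.
have [k [v [iv h]]] := fset_as_img (A `|` [fset x])%fset.
have [I ->] := h A (fsubsetUl _ _); have [J eJ] := h [fset x]%fset (fsubsetUr _ _).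
rewrite eJ -imgU.
pose B (b : bool) : {set 'I_k} := if b then (I :|: J)%SET else I.
have [/eqP cJ|cJ] := boolP (#|J| == 1%N); last first.
  move: eJ => /fsetP eJ; have : #|` img v J| = #|J|.
    rewrite /img card_imfset // -[size _]/(#|` fset_of J|).
    exact: card_fset_of.
  have -> : img v J = [fset x]%fset by apply/fsetP => y; rewrite -eJ.
  by rewrite cardfs1 => e; rewrite -e in cJ.
apply: (@transfer_rank _ _ B (fun r => (r true <= (r false).+1)%N)) => M G w.
rewrite /B imgU; apply: leq_trans (rkU_le _ _ _) _; rewrite -addn1 leq_add2l.
apply: leq_trans (leq_imfset_card _ _ _) _ => /=.
by rewrite -[size _]/(#|` fset_of J|) card_fset_of cJ.
Qed.

Lemma rkS_submod (A B : {fset S}) :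
  (rkS (A `|` B)%fset + rkS (A `&` B)%fset <= rkS A + rkS B)%N.
Proof.
have [k [v [iv h]]] := fset_as_img (A `|` B)%fset.
have [I ->] := h A (fsubsetUl _ _); have [J ->] := h B (fsubsetUr _ _).
rewrite -imgU -imgI //.
pose C (b : bool * bool) : {set 'I_k} :=
  if b.1 then if b.2 then (I :|: J)%SET else I else if b.2 then J else (I :&: J)%SET.
apply: (@transfer_rank _ _ C (fun r => (r (true, true) + r (false, false) <=
  r (true, false) + r (false, true))%N)) => M G w.
rewrite /C /= imgU; apply: leq_trans (rk_submod G _ _); rewrite leq_add2l.
by apply: rk_mono; rewrite fsubsetI !img_sub // ?subsetIl ?subsetIr.
Qed.

Lemma rkS0 : rkS (fset0 : {fset S}) = 0%N.
Proof. by apply/eqP; rewrite -leqn0 -(cardfs0 S) rkS_card. Qed.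

Definition struct_pregeometry : pregeometry S := Pregeometry rkS0 rkS_incr rkS_submod.

Lemma struct_interprets : interprets struct_pregeometry.
Proof.
move=> n t.
have e : t = map_tuple (tnth t) (ord_tuple n).
  by apply: val_inj; rewrite /= map_tnth_enum.
pose D : prop_on K0 'I_n := fun S g v =>
  (uniq (map v (ord_tuple n)) -> (n <= rkS (img v [set x in ord_tuple n]%SET))%N ->
    relI (map_tuple v (ord_tuple n))) /\
  (relI (map_tuple v (ord_tuple n)) -> uniq (map v (ord_tuple n)) /\
     (n <= rkS (img v [set x in ord_tuple n]%SET))%N).
have dD : definable D.
  have d1 := @def_rel K0 _ _ (ord_tuple n); have d2 := @def_uniq K0 _ _ (ord_tuple n).
  have d3 := (@nat_def_rkS K0 _ [set x in ord_tuple n]%SET).2 n.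
  by apply: def_and; [apply: def_imp => //; exact: def_imp|apply: def_imp => //; exact: def_and].
have [|h1 h2] := transfer mS dD inh0 _ tt (tnth t).
  move=> S' [G [iG _ _ _]] g w; rewrite /D (rkS_rk _ iG) img_tuple.
  rewrite (iG n (map_tuple w (ord_tuple n))) /indep_tuple /indep.
  rewrite -[map w _]/(tval (map_tuple w (ord_tuple n))).
  move: (map_tuple w _) => T; split=> [u r|[u r]].
    by split=> //; apply/eqP; rewrite eqn_leq rk_card /= card_fset_tuple.
  by split=> //; rewrite r card_fset_tuple.
move: h1 h2; rewrite img_tuple -e -[map _ (ord_tuple n)]/(tval (map_tuple _ (ord_tuple n))) -e.
move=> h1 h2; rewrite /indep_tuple /indep /=; split=> [/h2[u r]|[u r]]; last first.
  by apply: h1 => //; rewrite r card_fset_tuple.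
split=> //; apply/eqP; rewrite eqn_leq rkS_card /=.
by rewrite card_fset_tuple.
Qed.
End Existence.

(** * Definability of the defining conditions *)

Definition pregeom_of (S : Lstruct) : Type := {G : pregeometry S | interprets G}.

Section DimWitness.
Context (M : choiceType) (G : pregeometry M).

Lemma dim_geP n (Y : set M) : fin_dim G Y -> (n <= dim G Y)%N <->
  exists w : 'I_n -> M, (forall j, Y (w j)) /\ (n <= rk G (img w [set: 'I_n]%SET))%N.
Proof.
move=> fY; split=> [nY|[w [Yw nw]]]; last first.
  apply: leq_trans nw _; rewrite -dim_fset; apply: dim_le => // x /imgP[j _ ->].
  exact: Yw.
have [B iB sB] := fin_dim_basis fY; rewrite (spans_dim sB).2 iB in nY.
exists (fun i => tnth (in_tuple (enum_fset B)) (widen_ord nY i)).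
have inB i : tnth (in_tuple (enum_fset B)) (widen_ord nY i) \in B by exact: mem_tnth.
split=> [j|]; first exact: sB.1 _ (inB j).
set C := img _ _; have iC : indep G C.
  by apply: indep_sub iB; apply/fsubsetP => x /imgP[i _ ->].
rewrite iC /C /img card_imfset /=; last first.
  move=> i j e; apply/val_inj.
  have /tuple_uniqP u := fset_uniq B : uniq (in_tuple (enum_fset B)).
  exact: (congr1 val (u _ _ e)).
by rewrite -[size _]/(#|` fset_of _|) card_fset_of cardsT card_ord.
Qed.
End DimWitness.

Section RankDefinability.
Implicit Types (X I : finType).

Lemma nat_def_rk X (A : {set X}) :
  nat_definable (fun S (g : pregeom_of S) (v : X -> S) => rk (sval g) (img v A)).
Proof.
have -> : (fun S (g : pregeom_of S) (v : X -> S) => rk (sval g) (img v A)) =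
    (fun S (g : pregeom_of S) v => rkS (img v A)).
  apply: functional_extensionality_dep => S; apply/funext => g; apply/funext => v.
  by rewrite (rkS_rk _ (svalP g)).
exact: nat_def_rkS.
Qed.

Lemma fset_of_surj X (B : {fset X}) : B = fset_of [set x in B]%SET.
Proof. by apply/fsetP => x; rewrite in_fset_of inE. Qed.

Lemma pull_img X (M : choiceType) (G : pregeometry M) (v : X -> M) A :
  rk (pull G v) (fset_of A) = rk G (img v A).
Proof. by []. Qed.

(** The induced pregeometry is determined by finitely many bounded ranks. *)
Lemma def_pull X (Q : pregeometry X -> Prop) :
  definable (fun S (g : pregeom_of S) v => Q (pull (sval g) v)).
Proof.
have := @def_nat_rel pregeom_of X {set X} (fun A S g v => rk (sval g) (img v A))
  (fun r => exists H, (forall A, rk H (fset_of A) = r A) /\ Q H)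
  (fun A => nat_def_rk A).
apply: def_ext => S g v; split=> [[H [hH QH]]|QG]; last by exists (pull (sval g) v).
suff -> : pull (sval g) v = H by [].
by apply: pregeometry_eq => B; rewrite (fset_of_surj B) hH.
Qed.

(** Dimension at least n is witnessed by an n-tuple of rank n, and lying in
    the closures is a property of the pregeometry induced on the tuples. *)
Lemma nat_def_dim X I (A : I -> {set X}) (s : {set I}) : s != finset.set0 ->
  nat_definable (fun S (g : pregeom_of S) (v : X -> S) =>
    dim (sval g) (\bigcap_(i in [set j | j \in s]) clf (sval g) (img v (A i)))).
Proof.
move=> /set0Pn[i0 i0s].
have fd S (G : pregeometry S) (v : X -> S) :
    fin_dim G (\bigcap_(i in [set j | j \in s]) clf G (img v (A i))).
  by apply: fin_dim_sub (fin_dim_clf G (img v (A i0))) => x; apply.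
split.
  exists #|X| => S [G iG] v /=.
  apply: leq_trans (_ : (dim G (clf G (img v (A i0))) <= _)%N).
    by apply: dim_le (fin_dim_clf _ _) => x; apply.
  rewrite dim_clf; apply: leq_trans (rk_card _ _) _; exact: card_img.
move=> n.
pose Q (H : pregeometry (X + 'I_n)%type) :=
  (forall i j, i \in s -> clf H (fset_of (inl @: A i)%SET) (inr j)) /\
  (n <= rk H (fset_of (inr @: [set: 'I_n])%SET))%N.
have := def_exists (def_pull Q); apply: def_ext => S [G iG] v /=.
rewrite dim_geP //.
have eI (w : 'I_n -> S) i : img (sum_val v w) (inl @: A i)%SET = img v (A i).
  apply/fsetP => x; apply/imgP/imgP => [[z /imsetP[y yA ->] ->]|[y yA ->]].
    by exists y.
  by exists (inl y) => //; exact: imset_f.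
have eT (w : 'I_n -> S) : img (sum_val v w) (inr @: [set: 'I_n])%SET = img w [set: 'I_n]%SET.
  apply/fsetP => x; apply/imgP/imgP => [[z /imsetP[y yA ->] ->]|[y yA ->]].
    by exists y.
  by exists (inr y) => //; exact: imset_f.
split=> -[w [h1 h2]]; exists w.
  rewrite /Q pull_img eT in h2; split=> // j i /= si.
  have := h1 i j si.
  by move=> /(rank_map_clf (@pull_rank_map _ _ G (sum_val v w))); rewrite -/(img _ _) eI.
rewrite /Q pull_img eT; split=> // i j si.
apply/(rank_map_clf (@pull_rank_map _ _ G (sum_val v w))).
by rewrite -/(img _ _) eI; exact: h1.
Qed.

End RankDefinability.

Section RangeForms.
Context (X : finType) (M : choiceType) (G : pregeometry M) (v : X -> M).

Lemma rangeE : range v = [set` img v [set: X]%SET].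
Proof.
apply/seteqP; split=> y /=; first by case=> x _ <-; apply/imgP; exists x; rewrite ?inE.
by case/imgP => x _ ->; exists x.
Qed.

Lemma sub_range (A : set M) : A `<=` range v -> exists B : {set X}, A = [set` img v B].
Proof.
move=> sA; exists [set x | `[< A (v x) >]]%SET; apply/seteqP; split=> y /=.
  move=> Ay; have [x _ e] := sA y Ay; apply/imgP; exists x => //.
  by rewrite inE; apply/asboolP; rewrite e.
by case/imgP => x; rewrite inE => /asboolP Ax ->.
Qed.

Lemma clf_pull (A : {set X}) : clf (pull G v) (fset_of A) = v @^-1` (clf G (img v A)).
Proof. by apply/seteqP; split=> x /(rank_map_clf (@pull_rank_map _ _ G v)). Qed.

Lemma image_pre (E : set M) : v @` (v @^-1` E) = E `&` range v.
Proof.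
apply/seteqP; split=> y; first by case=> x Ex <-; split=> //; exists x.
by case=> Ey [x _ e]; exists x => //; rewrite /preimage /= e.
Qed.

Lemma star_rangeP : strong_star G (range v) <-> forall A1 A2 : {set X},
  dim G (clf G (img v A1) `&` clf G (img v A2))
  = dim (pull G v) (clf (pull G v) (fset_of A1) `&` clf (pull G v) (fset_of A2)).
Proof.
rewrite strong_starP.
have e A1 A2 : edim (pull G v) (clf (pull G v) (fset_of A1) `&` clf (pull G v) (fset_of A2))
    = edim G (clf G (img v A1) `&` clf G (img v A2) `&` range v).
  by rewrite (rank_map_edim (@pull_rank_map _ _ G v)) !clf_pull -preimage_setI image_pre.
have fI A1 A2 : fin_dim G (clf G (img v A1) `&` clf G (img v A2)).
  by apply: fin_dim_sub (fin_dim_clf G (img v A1)); exact: subIsetl.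
split=> [h A1 A2|h A1 A2].
  rewrite [RHS]/dim e /dim -!clE h // ; last 2 first.
  - by rewrite rangeE => x; apply: (fsubsetP (img_sub v (finset.subsetT A1))).
  - by rewrite rangeE => x; apply: (fsubsetP (img_sub v (finset.subsetT A2))).
move=> /sub_range[B1 ->] /sub_range[B2 ->]; rewrite !clE.
have := h B1 B2; rewrite [RHS]/dim e -/(dim _ _) => e2.
have f2 : fin_dim G (clf G (img v B1) `&` clf G (img v B2) `&` range v).
  by apply: fin_dim_sub (fI B1 B2); exact: subIsetl.
by rewrite (edim_fin f2) (edim_fin (fI B1 B2)) e2.
Qed.

(** A superset with at most n new points is listed by at most n further
    variables; the number j of variables varies so that j = 0 is available in
    the absence of new points. *)
Lemma nstrong_rangeP n : nstrong G n (range v) <-> strong_star G (range v) /\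
  forall (j : 'I_n.+1) (w : 'I_j -> M), strong_star G (range (sum_val v w)) ->
    strong_over (pull G (sum_val v w)) (range inl) setT.
Proof.
have so m (w : 'I_m -> M) : strong_over (pull G (sum_val v w)) (range inl) setT <->
    strong_in G (range v) (range (sum_val v w)).
  rewrite (rank_map_strong_over (@pull_rank_map _ _ G _)) strong_inP.
  have -> : sum_val v w @` range inl = range v.
    apply/seteqP; split=> y; first by case=> _ [x _ <-] <-; exists x.
    by case=> x _ <-; exists (inl x) => //; exists x.
  suff -> : range v `&` range (sum_val v w) = range v by [].
  by apply: setIidl => _ [x _ <-]; exists (inl x).
split=> -[st h]; split=> //.
  move=> j w stw; apply/so; apply: h => //.
    by move=> _ [x _ <-]; exists (inl x).
  have sub : range (sum_val v w) `\` range v `<=` range w.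
    by move=> _ [[[x|i] _ <-] nv]; [case: nv; exists x|exists i].
  apply: card_le_trans (subset_card_le sub) _.
  apply: card_le_trans (card_image_le _ _) _.
  by rewrite -(card_le_eql (@card_II j)) card_le_II -ltnS.
move=> Y vY stY cY; have cB := geq_card_fset_set cY.
have fD : finite_set (Y `\` range v) by apply/finite_set_leP; exists n.
set B := fset_set (Y `\` range v) in cB.
rewrite -ltnS in cB.
pose w (i : 'I_#|` B|) := tnth (in_tuple (enum_fset B)) i.
have eY : range (sum_val v w) = Y.
  apply/seteqP; split=> y.
    case=> -[x|i] _ <- /=; first by apply: vY; exists x.
    have : w i \in B by exact: mem_tnth.
    by rewrite in_fset_set // inE => -[].
  move=> Yy; have [[x _ <-]|nv] := pselect (range v y); first by exists (inl x).
  have /tnthP[i ->] : y \in in_tuple (enum_fset B).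
    by rewrite -[_ \in _]/(y \in B) in_fset_set // inE.
  by exists (inr i).
by have := h (Ordinal cB) w; rewrite so eY; apply.
Qed.
End RangeForms.

Section AxiomsDefinable.
Implicit Types (X : finType).

Lemma def_star X : definable (fun S (g : pregeom_of S) (v : X -> S) => strong_star (sval g) (range v)).
Proof.
pose A (p : {set X} * {set X}) (b : bool) := if b then p.1 else p.2.
have nz : [set: bool]%SET != finset.set0 by apply/set0Pn; exists true; rewrite inE.
have d (p : {set X} * {set X}) (n : 'I_#|X|.+1) := def_and
   (def_nat_eq n (@nat_def_dim X bool (A p) [set: bool]%SET nz))
   (@def_pull X (fun H => dim H (clf H (fset_of p.1) `&` clf H (fset_of p.2)) = n)).
apply: def_ext (def_all (fun p => def_ex (fun n => d p n))) => S [G iG] v /=.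
have cap p : \bigcap_(i in [set j | j \in [set: bool]%SET]) clf G (img v (A p i))
    = clf G (img v p.1) `&` clf G (img v p.2).
  apply/seteqP; split=> x; last by move=> [x1 x2] [] _.
  by move=> h; split; [apply: (h true)|apply: (h false)]; rewrite /= inE.
rewrite star_rangeP; split=> [h A1 A2|h p].
  by have [n [<-]] := h (A1, A2); rewrite cap.
have lt : (dim G (clf G (img v p.1) `&` clf G (img v p.2)) < #|X|.+1)%N.
  rewrite ltnS; apply: leq_trans (_ : (dim G (clf G (img v p.1)) <= _)%N).
    by apply: dim_le (fin_dim_clf _ _); exact: subIsetl.
  by rewrite dim_clf; apply: leq_trans (rk_card _ _) _; exact: card_img.
by exists (Ordinal lt); rewrite cap /= -h.
Qed.

Lemma def_nstrong X n :
  definable (fun S (g : pregeom_of S) (v : X -> S) => nstrong (sval g) n (range v)).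
Proof.
have d (j : 'I_n.+1) := def_forall (def_imp (def_star (X + 'I_j)%type)
  (@def_pull (X + 'I_j)%type (fun H => strong_over H (range inl) setT))).
apply: def_ext (def_and (def_star X) (def_all d)) => S g v.
by rewrite nstrong_rangeP.
Qed.

Lemma def_injective X : definable (fun S (g : pregeom_of S) (v : X -> S) => injective v).
Proof.
have d (p : X * X) := def_imp (@def_eq pregeom_of X p.1 p.2) (@def_const pregeom_of X (p.1 = p.2)).
apply: def_ext (def_all d) => S g v; split=> [h x y|h [x y] /=]; first exact: (h (x, y)).
exact: h.
Qed.

Lemma def_embedding X (H : pregeometry X) :
  definable (fun S (g : pregeom_of S) (v : X -> S) => embedding H (sval g) v).
Proof.
apply: def_ext (def_and (def_injective X) (@def_pull X (fun P => P = H))) => S g v.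
by rewrite /embedding -/(rank_map H (sval g) v) rank_map_pull.
Qed.

(** One instance of the extension condition, with the finite strong set given
    by a tuple v indexed by X and its inclusion in H given by e. *)
Definition extends_tuple (m n : nat) (M : choiceType) (G : pregeometry M)
    (X T : finType) (H : pregeometry T) (e : X -> T) (v : X -> M) : Prop :=
  embedding (pull H e) G v -> nstrong G m (range v) ->
  exists w : T -> M, [/\ embedding H G w, forall x, w (e x) = v x & nstrong G n (range w)].

Lemma def_extends_tuple m n (X T : finType) (H : pregeometry T) (e : X -> T) :
  definable (fun S (g : pregeom_of S) (v : X -> S) => extends_tuple m n (sval g) H e v).
Proof.
have inr' (P : prop_on pregeom_of T) := @def_ren pregeom_of T (X + T)%type inr P.
have d1 := inr' _ (def_embedding H); have d2 := inr' _ (def_nstrong T n).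
have d3 : definable (fun S (g : pregeom_of S) (v : X + T -> S) => forall x, v (inr (e x)) = v (inl x)).
  by apply: def_all => x; exact: def_eq.
have d := def_exists (def_and d1 (def_and d3 d2)).
apply: def_ext (def_imp (def_embedding (pull H e)) (def_imp (def_nstrong X m) d)) => S g v.
have i2 (w : T -> S) : sum_val v w \o inr = w by [].
split=> h h1 h2; have := h h1 h2.
  by move=> [w [? [? ?]]]; exists w.
by move=> [w [? ? ?]]; exists w.
Qed.

Lemma embed_range (M : choiceType) (G : pregeometry M) (X T : finType)
    (H : pregeometry T) (e : X -> T) (v : X -> M) :
  injective e -> embedding (pull H e) G v ->
  exists e' : range v -> T,
    [/\ embedding (Defs.restrict G (range v)) H e', range e' = range e &
        forall x a, val a = v x -> e' a = e x].
Proof.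
move=> ie [iv ev].
have /choice[h hP] : forall a : range v, exists x, v x = val a.
  by move=> a; have [x _ e'] := set_valP a; exists x.
have hv x a : val a = v x -> h a = x by move=> ax; apply: iv; rewrite hP.
exists (e \o h); split=> [|//|x a ax]; last by rewrite /= (hv x).
- split=> [a b /= /ie eh|A]; first by apply: val_inj; rewrite -!hP eh.
  have -> : [fset (e \o h) x | x in A]%fset = [fset e x | x in [fset h x | x in A]%fset]%fset.
    apply/fsetP => y; apply/imfsetP/imfsetP => /= -[x xA ->].
      by exists (h x) => //; apply/imfsetP; exists x.
    by case/imfsetP: xA => z /= zA ->; exists z.
  rewrite -[LHS]/(rk (pull H e) _) -ev /= /sub_rk; congr rk.
  apply/fsetP => y; apply/imfsetP/imfsetP => /= -[x xA ->].
    by case/imfsetP: xA => z /= zA ->; exists z => //; rewrite hP.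
  by exists (h x); rewrite ?hP //; apply/imfsetP; exists x.
apply/seteqP; split=> _ [x _ <-]; first by exists (h x).
by exists (SigSub (mem_set (imageT v x))) => //=; rewrite (hv x).
Qed.

Lemma extension_axiomP tau (M : choiceType) (G : pregeometry M) :
  extension_axiom tau G <->
  forall (X T : finType) (H : pregeometry T) (e : X -> T) n, injective e -> flat H ->
    strong H (range e) -> forall v, extends_tuple (tau (#|T| + n)%N) n G H e v.
Proof.
split=> [ext X T H e n ie fH se v ev nv|ext F finF stF T H e fH [ie ee] se n nF].
  have [e' [emb re eP]] := embed_range ie ev.
  have finv : finite_set (range v) by rewrite rangeE; exact: finite_fset.
  have [|w [ew we nw]] := ext _ finv nv.1 T H e' fH emb _ n nv; first by rewrite re.
  exists w; split=> // x; have := we (SigSub (mem_set (imageT v x))).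
  by rewrite (eP x).
pose B := fset_set F; have BF x : (x \in B) <-> F x.
  by rewrite /B in_fset_set // inE.
pose h (x : B) : F := SigSub (mem_set ((BF (val x)).1 (valP x))).
have hv x : val (h x) = val x by [].
have rv : range (val : B -> M) = F.
  apply/seteqP; split=> y; first by case=> x _ <-; apply/BF; exact: valP.
  by move=> /BF yB; exists [` yB]%fset.
have ih : injective h by move=> x y /(congr1 val); rewrite !hv; exact: val_inj.
have sh a : exists x, h x = a.
  have /BF aB := set_valP a; exists [` aB]%fset; exact: val_inj.
have re : range (e \o h) = range e.
  apply/seteqP; split=> _ [x _ <-]; first by exists (h x).
  by have [y <-] := sh x; exists y.
have := ext B T H (e \o h) n (inj_comp ie ih) fH _ val; rewrite re => /(_ se).
rewrite /extends_tuple rv => /(_ _ nF) [].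
  split; first exact: val_inj.
  move=> A; rewrite /= /pull_rk.
  have -> : [fset (e \o h) x | x in A]%fset = [fset e x | x in [fset h x | x in A]%fset]%fset.
    apply/fsetP => y; apply/imfsetP/imfsetP => /= -[x xA ->].
      by exists (h x) => //; apply/imfsetP; exists x.
    by case/imfsetP: xA => z /= zA ->; exists z.
  rewrite ee /= /sub_rk; congr rk.
  apply/fsetP => y; apply/imfsetP/imfsetP => /= -[x xA ->].
    by exists (h x) => //; apply/imfsetP; exists x.
  by case/imfsetP: xA => z /= zA ->; exists z.
move=> w [ew we nw]; exists w; split=> // a.
by have [x <-] := sh a; rewrite we.
Qed.
End AxiomsDefinable.

Section FlatTuples.
Implicit Types (X : finType).

Definition flat_tuple (M : choiceType) (G : pregeometry M) k X (A : 'I_k -> {set X})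
    (v : X -> M) : Prop :=
  ((rk G (img v (\bigcup_i A i)%SET))%:Z
     <= Delta G (fun i => clf G (img v (A i))))%R.

(** A finite family of finite-dimensional closed sets is given by bases, which
    are subsets of a single finite set. *)
Lemma flat_tupleP (M : choiceType) (G : pregeometry M) :
  flat G <-> forall k m (A : 'I_k -> {set 'I_m}) (v : 'I_m -> M), flat_tuple G A v.
Proof.
have un k X (A : 'I_k -> {set X}) (v : X -> M) :
    dim G (\bigcup_i clf G (img v (A i))) = rk G (img v (\bigcup_i A i)%SET).
  apply: (spans_dim _).2; split=> x.
    case/imgP => y /bigcupP[i _ yA] ->; exists i => //.
    by apply: mem_clf; apply/imgP; exists y.
  case=> i _; apply: clf_mono; apply: img_sub.
  exact: (finset.bigcup_sup i).
split=> [fG k m A v|h k E fE].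
  rewrite /flat_tuple -un; apply: fG => i; split; first exact: closed_clf.
  exact: fin_dim_clf.
have /choice[B sB] i : exists B, spans G B (E i) by apply: fin_dim_spans; exact: (fE i).2.
pose C := (\bigcup_(i <- enum 'I_k) B i)%fset.
have BC i : (B i `<=` C)%fset.
  by apply/fsubsetP => x xB; apply/bigfcupP; exists i; rewrite ?mem_enum.
have [m [v [iv hv]]] := fset_as_img C.
have /choice[A eA] i : exists I : {set 'I_m}, B i = img v I by exact: hv.
have eE : E = fun i => clf G (img v (A i)).
  apply/funext => i; rewrite -eA; apply/seteqP; split; first exact: (sB i).2.
  by rewrite -clE; apply: cl_min; [exact: (fE i).1|exact: (sB i).1].
by have := h k m A v; rewrite /flat_tuple -un -eE.
Qed.

Lemma def_flat_tuple k X (A : 'I_k -> {set X}) :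
  definable (fun S (g : pregeom_of S) (v : X -> S) => flat_tuple (sval g) A v).
Proof.
pose f (o : option {set 'I_k}) S (g : pregeom_of S) (v : X -> S) : nat :=
  if o is Some s then if s == finset.set0 then 0 else
    dim (sval g) (\bigcap_(i in [set j | j \in s]) clf (sval g) (img v (A i)))
  else rk (sval g) (img v (\bigcup_i A i)%SET).
have df o : nat_definable (f o).
  case: o => [s|]; last exact: nat_def_rk.
  have [s0|s0] := eqVneq s finset.set0; rewrite /f ?s0 ?eqxx ?(negbTE s0); last exact: nat_def_dim.
  split; first by exists 0%N.
  by move=> n; exact: def_const.
pose R (r : option {set 'I_k} -> nat) : Prop := ((r None)%:Z <=
  \sum_(s : {set 'I_k} | (0 < #|s|)%N) (-1) ^+ (#|s|.+1) * (r (Some s))%:Z)%R.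
have := def_nat_rel R df; apply: def_ext => S [G iG] v.
rewrite /R /flat_tuple /Delta /f /=.
suff -> : (\sum_(s : {set 'I_k} | (0 < #|s|)%N) (-1) ^+ #|s|.+1 *
   (if s == finset.set0 then 0%N else
     dim G (\bigcap_(i in [set j | j \in s]) clf G (img v (A i))))%:Z)%R =
   (\sum_(s : {set 'I_k} | (0 < #|s|)%N) (-1) ^+ #|s|.+1 *
    (dim G (\bigcap_(i in [set j | j \in s]) clf G (img v (A i))))%:Z)%R by [].
by apply: eq_bigr => s; rewrite card_gt0 => /negbTE ->.
Qed.

Lemma infinite_dimP (M : choiceType) (G : pregeometry M) : ~ fin_dim G setT <->
  forall n, exists w : 'I_n -> M, (n <= rk G (img w [set: 'I_n]%SET))%N.
Proof.
split=> [nf n|h [n bn]].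
  have [m [A [iA _ ->]] /negP nm] : exists2 m, indep_sizes G setT m & ~ (m <= n)%N.
    apply: contrapT => h; apply: nf; exists n => m sm; apply: contrapT => nm.
    by apply: h; exists m.
  have := dim_geP n (fin_dim_fset G A); rewrite dim_fset iA => -[+ _].
  case=> [|w [_ h]]; last by exists w.
  by rewrite ltnW // ltnNge.
have [w hw] := h n.+1.
have [B iB sB] := fin_dim_basis (fin_dim_fset G (img w [set: 'I_n.+1]%SET)).
have : indep_sizes G setT #|` B| by exists B; split.
move/bn; rewrite leqNgt -iB -(spans_dim sB).2 dim_fset.
by rewrite hw.
Qed.

Lemma def_rank_witness n : definable (fun S (g : pregeom_of S) (v : void -> S) =>
   exists w : 'I_n -> S, (n <= rk (sval g) (img w [set: 'I_n]%SET))%N).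
Proof.
have d := def_ren (fun i : 'I_n => inr i : (void + 'I_n)%type) ((nat_def_rk [set: 'I_n]%SET).2 n).
have := def_exists d; apply: def_ext => S g v.
by split=> -[w h]; exists w.
Qed.
End FlatTuples.

(** Each condition is a conjunction of universally quantified definable
    properties, so it passes from all structures satisfying the conditions to
    all models of their common theory. *)
Theorem models_T_axioms tau (S : Lstruct) : models S (T_ tau) <-> T_axioms tau S.
Proof.
split=> [mS|TS phi]; last exact.
have inh S' : T_axioms tau S' -> exists g : pregeom_of S', True.
  by move=> [G [iG _ _ _]]; exists (exist _ G iG).
have iG := struct_interprets mS; set G := struct_pregeometry mS in iG.
pose g : pregeom_of S := exist _ G iG.
have same S' (h : pregeom_of S') (G' : pregeometry S') : interprets G' -> sval h = G'.
  by move=> iG'; apply: interprets_uniq => //; exact: svalP h.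
exists G; split=> //.
- apply/flat_tupleP => k m A v.
  apply: (transfer mS (def_flat_tuple A) inh _ g v) => S' [G' [iG' fG' _ _]] h w.
  by rewrite (same _ h _ iG'); move/flat_tupleP: fG'; apply.
- apply/infinite_dimP => n.
  apply: (transfer mS (def_rank_witness n) inh _ g (fun x : void => match x with end)).
  move=> S' [G' [iG' _ nf _]] h w.
  by rewrite (same _ h _ iG'); move/infinite_dimP: nf; apply.
- apply/extension_axiomP => X T H e n ie fH se v.
  apply: (transfer mS (def_extends_tuple _ n H e) inh _ g v) => S' [G' [iG' _ _ ax]] h w.
  by rewrite (same _ h _ iG'); move/extension_axiomP: ax; apply.
Qed.

(** * Ultrapowers over the natural numbers *)

Section Ultrapower.
Variables (S : Lstruct) (U : set_system nat).
Context {UU : UltraFilter U}.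

Definition agree (f g : nat -> S) : Prop := U [set i | f i = g i].

Lemma agree_refl f : agree f f.
Proof. by apply: filterS filterT => i _ /=. Qed.

Lemma agree_sym f g : agree f g -> agree g f.
Proof. by apply: filterS => i /= ->. Qed.

Lemma agree_trans f g h : agree f g -> agree g h -> agree f h.
Proof. by move=> fg gh; apply: filterS (filterI fg gh) => i /= [-> ->]. Qed.

(** Elements are the equivalence classes themselves, as sets of sequences, so
    that equality of elements is agreement almost everywhere. *)
Definition ultra_carrier : Type := {A : set (nat -> S) | exists f, A = agree f}.
Definition ultra_dom : choiceType := {classic ultra_carrier}.

Definition cls (f : nat -> S) : ultra_dom := exist _ (agree f) (ex_intro _ f erefl).
Definition rep (x : ultra_dom) : nat -> S := projT1 (cid (svalP x)).

Lemma ultra_dom_inj (x y : ultra_dom) : sval x = sval y -> x = y.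
Proof.
case: x y => [A pA] [B pB] /= e; subst B.
by congr exist; exact: Prop_irrelevance.
Qed.

Lemma clsP f g : cls f = cls g <-> agree f g.
Proof.
split=> [[e]|fg]; first by rewrite e; exact: agree_refl.
apply: ultra_dom_inj; apply/seteqP; split=> h; last exact: agree_trans.
by apply: agree_trans; exact: agree_sym.
Qed.

Lemma repK : cancel rep cls.
Proof.
by move=> x; apply: ultra_dom_inj; rewrite /rep; case: cid.
Qed.

Lemma rep_cls f : agree (rep (cls f)) f.
Proof. by apply/clsP; exact: repK. Qed.

Definition ultrapower : Lstruct :=
  {| dom := ultra_dom;
     relI := fun n (t : n.-tuple ultra_dom) =>
       U [set i | relI (map_tuple (fun x => rep x i) t)] |}.

Lemma ultra_imp (A B : set nat) : U [set i | A i -> B i] <-> (U A -> U B).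
Proof.
split=> [UAB UA|h]; first by apply: filterS (filterI UAB UA) => i [].
have [UA|UA] := in_ultra_setVsetC A UU; last by apply: filterS UA => i nA /nA.
by apply: filterS (h UA) => i Bi _.
Qed.

Lemma los k (phi : formula k) (a : 'I_k -> nat -> S) :
  sat (S := ultrapower) phi (fun j => cls (a j)) <-> U [set i | sat phi (fun j => a j i)].
Proof.
elim: k / phi a => [k|k i j|k n t|k p1 IH1 p2 IH2|k p IH] a /=.
- split=> // UF; have := filter_not_empty U; apply.
  by apply: filterS UF.
- exact: clsP.
- have all : U [set i | forall j, rep (cls (a j)) i = a j i].
    by apply: filter_forall => j; exact: rep_cls.
  have e i : (forall j, rep (cls (a j)) i = a j i) ->
      map_tuple (fun x => rep x i) (map_tuple (fun j => cls (a j)) t) =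
      map_tuple (fun j => a j i) t.
    by move=> h; apply: val_inj; rewrite /= -map_comp; apply: eq_map => j /=.
  by split=> h; apply: filterS (filterI h all) => i /= [h1 /e e1]; rewrite ?e1 // -e1.
- by rewrite ultra_imp IH1 IH2.
- have vc (f : nat -> S) : vcons (cls f) (fun j => cls (a j)) =
      (fun j => cls (vcons f a j)).
    by apply/funext => j; rewrite /vcons; case: (unlift ord0 j).
  have vc2 (f : nat -> S) i : (fun j => vcons f a j i) = vcons (f i) (fun j => a j i).
    by apply/funext => j; rewrite /vcons; case: (unlift ord0 j).
  split=> [h|h x]; last first.
    rewrite -(repK x) vc IH; apply: filterS h => i h /=.
    by rewrite vc2; exact: h.
  have [[x0 _]|nS] := pselect (exists x : S, True); last first.
    by apply: filterS filterT => i _ x; case: nS; exists x.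
  apply: contrapT => nU.
  have [//|UA] := in_ultra_setVsetC [set i | forall x, sat p (vcons x (fun j => a j i))] UU.
  have /choice[f hf] i : exists x, (exists y, ~ sat p (vcons y (fun j => a j i))) ->
      ~ sat p (vcons x (fun j => a j i)).
    have [[y ny]|ne] := pselect (exists y, ~ sat p (vcons y (fun j => a j i))).
      by exists y.
    by exists x0.
  have := h (cls f); rewrite vc IH => Uf.
  have := filter_not_empty U; apply; apply: filterS (filterI Uf UA) => i [h1 /= /existsNP h2].
  by apply: (hf i h2); rewrite -vc2.
Qed.

Lemma ultrapower_elementary (phi : sentence) : holds ultrapower phi <-> holds S phi.
Proof.
have e1 : @no_var ultrapower = fun j => cls (no_var _ j) by apply/funext => -[].
have e2 i : (fun j => no_var (nat -> S) j i) = @no_var S by apply/funext => -[].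
rewrite /holds e1 los; split=> [h|h].
  by have [i /=] := filter_ex h; rewrite e2.
by apply: filterS filterT => i _ /=; rewrite e2.
Qed.

Lemma los_val (X : finType) (phi : formula #|X|) (v : X -> ultrapower) :
  sat (S := ultrapower) phi (v \o @var_of X) <->
  U [set i | sat phi ((fun x => rep (v x) i) \o @var_of X)].
Proof.
have -> : v \o @var_of X = fun j => cls (rep (v (var_of j))).
  by apply/funext => j; rewrite repK.
exact: los.
Qed.

Hypothesis Ufree : forall n, U [set i | (n <= i)%N].

(** Diagonal argument: in coordinate i choose a tuple satisfying as many of
    the first i formulas as possible.  For each m, almost all coordinates are
    at least m and admit a tuple satisfying the formulas up to m. *)
Lemma saturation (X Y : finType) (phi : nat -> formula #|{: X + Y}|) (v : X -> ultrapower) :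
  (forall n, exists w : Y -> ultrapower, forall m, (m <= n)%N ->
     sat (phi m) (sum_val v w \o @var_of _)) ->
  exists w : Y -> ultrapower, forall m, sat (phi m) (sum_val v w \o @var_of _).
Proof.
move=> h; pose a i x := rep (v x) i.
have rsum (w : Y -> ultrapower) i : (fun z => rep (sum_val v w z) i) =
    sum_val (a i) (fun y => rep (w y) i) by apply/funext => -[].
pose B n i := exists w : Y -> S, forall m, (m <= n)%N ->
   sat (phi m) (sum_val (a i) w \o @var_of _).
have UB n : U (B n).
  have [w hw] := h n.
  have : U [set i | forall m : 'I_n.+1,
      sat (phi m) (sum_val (a i) (fun y => rep (w y) i) \o @var_of _)].
    apply: filter_forall => m; have := hw m; rewrite los_val -ltnS ltn_ord => /(_ isT).
    by apply: filterS => i /=; rewrite rsum.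
  apply: filterS => i hi; exists (fun y => rep (w y) i) => m; rewrite -ltnS => lt.
  exact: (hi (Ordinal lt)).
have [w0 _] := h 0%N.
have /choice[w hw] i : exists w : Y -> S, forall n, (n <= i)%N -> B n i ->
    forall m, (m <= n)%N -> sat (phi m) (sum_val (a i) w \o @var_of _).
  have [ex|nex] := pselect (exists n, (n <= i)%N && `[< B n i >]); last first.
    exists (fun y => rep (w0 y) i) => n ni Bn; case: nex; exists n.
    by rewrite ni; exact/asboolP.
  have ub n : (n <= i)%N && `[< B n i >] -> (n <= i)%N by case/andP.
  case: (ex_maxnP ex ub) => n /andP[ni /asboolP[w hw]] nmax.
  exists w => n' n'i Bn' m mn'; apply: hw; apply: leq_trans mn' _.
  by apply: nmax; rewrite n'i; exact/asboolP.
exists (fun y => cls (fun i => w i y)) => m.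
rewrite los_val.
have all : U [set i | forall y, rep (cls (fun i => w i y)) i = w i y].
  by apply: filter_forall => y; exact: rep_cls.
apply: filterS (filterI (filterI (UB m) (Ufree m)) all) => i [[Bi mi] e] /=.
rewrite rsum (_ : (fun y => _) = w i); first exact: hw Bi _ _.
by apply/funext => y; rewrite e.
Qed.
End Ultrapower.

Lemma free_ultrafilter : exists U : set_system nat,
  UltraFilter U /\ forall n, U [set i | (n <= i)%N].
Proof.
have [U [UU sub]] := ultraFilterLemma eventually_filter.
by exists U; split=> // n; apply: sub; exists n.
Qed.

(** * Back and forth between strong finite sets *)

Definition strong_closures (M : choiceType) (G : pregeometry M) : Prop :=
  forall X : {fset M}, exists Y : {fset M},
    [/\ (X `<=` Y)%fset, strong G [set` Y] & flat_on G [set` Y]].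

(** The extension property shared by the generic pregeometry and the
    ultrapower, for embeddings of tuples. *)
Definition rich (M : choiceType) (G : pregeometry M) : Prop :=
  forall (X T : finType) (H : pregeometry T) (e : X -> T) (v : X -> M),
    injective e -> flat H -> strong H (range e) ->
    embedding (pull H e) G v -> strong G (range v) ->
    exists w : T -> M,
      [/\ embedding H G w, forall x, w (e x) = v x & strong G (range w)].

Lemma generic_rich (M : choiceType) (G : pregeometry M) : generic G -> rich G.
Proof.
move=> [_ _ ext _] X T H e v ie fH se ev sv.
have [e' [emb re eP]] := embed_range ie ev.
have finv : finite_set (range v) by rewrite rangeE; exact: finite_fset.
have [|w [ew we nw]] := ext _ finv sv T H e' fH emb; first by rewrite re.
exists w; split=> // x; have := we (SigSub (mem_set (imageT v x))).
by rewrite (eP x).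
Qed.

Lemma generic_strong_closures (M : choiceType) (G : pregeometry M) :
  generic G -> strong_closures G.
Proof.
move=> [_ [fl _] _ clos] X; have [A [fA XA sA]] := clos _ (finite_fset X).
have e : [set` fset_set A] = A by apply: fset_setK.
exists (fset_set A); rewrite e; split=> //; last by apply/flat_restrictP; exact: fl.
by apply/fsubsetP => x /XA Ax; rewrite in_fset_set // inE.
Qed.

Lemma flat_strong_closures (M : choiceType) (G : pregeometry M) :
  flat G -> strong_closures G.
Proof.
move=> fG X; have [Y [XY /strong_fsetP sY]] := exists_strong ((flat_familyP G).1 fG) X.
exists Y; split=> //; apply: flat_on_star => //; exact: strong_star_fset.
Qed.

Lemma strong_nstrong (M : choiceType) (G : pregeometry M) (X : {fset M}) n :
  strong G [set` X] -> nstrong G n [set` X].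
Proof.
move=> sX; split; first exact: strong_star_fset.
move=> Y XY stY cY; rewrite strong_inP (setIidl XY).
have fD : finite_set (Y `\` [set` X]) by apply/finite_set_leP; exists n.
have fY : finite_set Y.
  rewrite -(setDUK XY) finite_setU; split=> //; exact: finite_fset.
have e : [set` fset_set Y] = Y by apply: fset_setK.
rewrite -e in stY *; apply: strong_over_star => //.
by apply/fsubsetP => x /XY Yx; rewrite in_fset_set // inE.
Qed.

Lemma nstrongW (M : choiceType) (G : pregeometry M) (X : set M) m n : (m <= n)%N ->
  nstrong G n X -> nstrong G m X.
Proof.
move=> mn [st h]; split=> // Y XY stY cY; apply: h => //.
by apply: card_le_trans cY _; rewrite card_le_II.
Qed.

(** A strong set is n-strong for every n, so the extension condition gives
    embeddings with n-strong image for each n; being such an embedding is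
    definable, so one embedding has all these properties by saturation. *)
Lemma ultrapower_rich tau (S : Lstruct) (U : set_system nat) (UU : UltraFilter U)
    (G : pregeometry (ultrapower S U)) :
  (forall n, U [set i | (n <= i)%N]) ->
  interprets G -> flat G -> extension_axiom tau G -> rich G.
Proof.
move=> Ufree iG fG /extension_axiomP ext X T H e v ie fH se ev sv.
have d n : definable (fun S (g : pregeom_of S) (u : X + T -> S) =>
    embedding H (sval g) (u \o inr) /\ (forall x, u (inr (e x)) = u (inl x)) /\
    nstrong (sval g) n (range (u \o inr))).
  apply: def_and; first exact: (def_ren inr (def_embedding H)).
  apply: def_and; last exact: (def_ren inr (def_nstrong T n)).
  by apply: def_all => x; exact: def_eq.
have /choice[phi hphi] : forall n, exists phi : formula #|{: X + T}|,
  forall (S : Lstruct) (g : pregeom_of S) (u : X + T -> S), sat phi (u \o @var_of _) <->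
    embedding H (sval g) (u \o inr) /\ (forall x, u (inr (e x)) = u (inl x)) /\
    nstrong (sval g) n (range (u \o inr)) by move=> n; exact: d.
pose g : pregeom_of (ultrapower S U) := exist _ G iG.
have [|w hw] := saturation Ufree (phi := phi) (v := v).
  move=> n; have nv : nstrong G (tau (#|T| + n)%N) (range v).
    by rewrite rangeE; apply: strong_nstrong; rewrite -rangeE.
  have [w [ew we nw]] := ext X T H e n ie fH se v ev nv.
  exists w => m mn; apply/(hphi m _ g); split=> //; split=> //.
  exact: nstrongW nw.
have {}hw m := (hphi m _ g (sum_val v w)).1 (hw m).
exists w; split; [exact: (hw 0%N).1|exact: (hw 0%N).2.1|].
rewrite rangeE; apply: nstrong_strong => // n; rewrite -rangeE.
exact: (hw n).2.2.
Qed.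

Section BackAndForth.

(** The tuples v1 and v2 correspond under an isomorphism between strong finite
    subsets; the common isomorphism type H lives on a finite type T. *)
Definition strong_iso (M1 M2 : choiceType) (G1 : pregeometry M1) (G2 : pregeometry M2)
    k (v1 : 'I_k -> M1) (v2 : 'I_k -> M2) : Prop :=
  exists (T : finType) (H : pregeometry T) (f1 : T -> M1) (f2 : T -> M2) (w : 'I_k -> T),
    [/\ embedding H G1 f1 /\ strong G1 (range f1),
        embedding H G2 f2 /\ strong G2 (range f2), v1 = f1 \o w & v2 = f2 \o w].

Lemma strong_iso_sym M1 M2 G1 G2 k v1 v2 :
  @strong_iso M1 M2 G1 G2 k v1 v2 -> strong_iso G2 G1 v2 v1.
Proof. by move=> [T [H [f1 [f2 [w [? ? ? ?]]]]]]; exists T, H, f2, f1, w. Qed.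

(** Enlarge the strong set on the first side to a finite strong set Y
    containing the new point; the old set is strong in Y, and Y is flat, so it
    embeds over the old set on the second side. *)
Lemma strong_iso_forth M1 M2 G1 G2 k v1 v2 x1 :
  strong_closures G1 -> rich G2 -> @strong_iso M1 M2 G1 G2 k v1 v2 ->
  exists x2, strong_iso G1 G2 (vcons x1 v1) (vcons x2 v2).
Proof.
move=> clos1 rich2 [T [H [f1 [f2 [w [[e1 s1] [e2 s2] -> ->]]]]]].
have [Y [XY sY fY]] := clos1 (img f1 [set: T]%SET `|` [fset x1])%fset.
move: XY; rewrite fsubUset fsub1set => /andP[/fsubsetP f1Y x1Y].
have {}f1Y t : f1 t \in Y by apply: f1Y; apply/imgP; exists t; rewrite ?inE.
pose h t : Y := [` f1Y t]%fset.
pose H2 : pregeometry Y := pull G1 val.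
have rY : range (val : Y -> M1) = [set` Y].
  apply/seteqP; split=> y; first by case=> z _ <-; exact: valP.
  by move=> yY; exists [` yY]%fset.
have ih : injective h by move=> t u /(congr1 val) /= /e1.1.
have fH2 : flat H2.
  by apply/flat_onP; rewrite (rank_map_flat_on (@pull_rank_map _ _ G1 val)) rY.
have sh : strong H2 (range h).
  apply/strongP; rewrite (rank_map_strong_over (@pull_rank_map _ _ G1 val)) rY.
  have -> : val @` range h = [set` img f1 [set: T]%SET].
    rewrite -rangeE; apply/seteqP; split=> y; first by case=> _ [t _ <-] <-; exists t.
    by case=> t _ <-; exists (h t) => //; exists t.
  apply: strong_over_star.
  - by apply/fsubsetP => y /imgP[t _ ->].
  - by rewrite -rangeE.
  - exact: strong_star_fset.
have eh : pull H2 h = H.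
  rewrite -(rank_map_pull H G1 f1).1; last exact: e1.2.
  apply: pregeometry_eq => A; rewrite /= /pull_rk /= /pull_rk; congr rk.
  apply/fsetP => y; apply/imfsetP/imfsetP => /= -[z zA ->].
    by case/imfsetP: zA => t /= tA ->; exists t.
  by exists (h z) => //; apply/imfsetP; exists z.
have [|g [eg gh sg]] := rich2 T Y H2 h f2 ih fH2 sh _ s2; first by rewrite eh.
exists (g [` x1Y]%fset), Y, H2, val, g, (vcons [` x1Y]%fset (h \o w)).
split=> //.
- by split; [split=> // y z; exact: val_inj|rewrite rY].
- by apply/funext => i; rewrite /vcons /=; case: (unlift ord0 i).
- by apply/funext => i; rewrite /vcons /=; case: (unlift ord0 i) => //= j; rewrite gh.
Qed.

Lemma indep_tuple_embedding (M1 M2 : choiceType) (G1 : pregeometry M1) (G2 : pregeometry M2)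
    (f : M1 -> M2) n (t : n.-tuple M1) :
  embedding G1 G2 f -> indep_tuple G2 (map_tuple f t) <-> indep_tuple G1 t.
Proof.
move=> [jf ef]; rewrite /indep_tuple /indep /= map_inj_uniq //.
have -> : [fset x in map f t]%fset = [fset f x | x in [fset x in tval t]%fset]%fset.
  apply/fsetP => y; rewrite inE; apply/mapP/imfsetP => /= -[x xt ->]; exists x => //.
    by rewrite inE.
  by rewrite inE in xt.
by rewrite ef card_imfset.
Qed.

Lemma strong_iso_sat (S1 S2 : Lstruct) (G1 : pregeometry S1) (G2 : pregeometry S2) :
  interprets G1 -> interprets G2 -> strong_closures G1 -> strong_closures G2 ->
  rich G1 -> rich G2 -> forall k (phi : formula k) v1 v2, strong_iso G1 G2 v1 v2 ->
  sat phi v1 <-> sat phi v2.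
Proof.
move=> i1 i2 c1 c2 r1 r2 k phi.
elim: k / phi => [k|k i j|k n t|k p IHp q IHq|k p IH] v1 v2 iso /=.
- by [].
- have [T [H [f1 [f2 [w [[[j1 _] _] [[j2 _] _] -> ->]]]]]] := iso.
  by split=> [/j1 /= ->|/j2 /= ->].
- have [T [H [f1 [f2 [w [[e1 _] [e2 _] -> ->]]]]]] := iso.
  rewrite i1 i2.
  have e (A : Type) (f : T -> A) : map_tuple (f \o w) t = map_tuple f (map_tuple w t).
    by apply: val_inj; rewrite /= map_comp.
  by rewrite !e (indep_tuple_embedding _ e1) (indep_tuple_embedding _ e2); split.
- by have := IHp _ _ iso; have := IHq _ _ iso; tauto.
split=> h x.
  have [y /strong_iso_sym iy] := strong_iso_forth x c2 r1 (strong_iso_sym iso).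
  by apply/(IH _ _ iy); exact: h.
have [y iy] := strong_iso_forth x c1 r2 iso.
by apply/(IH _ _ iy); exact: h.
Qed.
End BackAndForth.

Lemma dim_on0 (M : choiceType) (G : pregeometry M) : dim_on G set0 = fun=> 0%R.
Proof. by apply/funext => A; rewrite /dim_on setI0 /dimz dim0. Qed.

Lemma strong_iso_empty (M1 M2 : choiceType) (G1 : pregeometry M1) (G2 : pregeometry M2)
    (v1 : 'I_0 -> M1) (v2 : 'I_0 -> M2) :
  flat G1 -> generic G2 -> strong_iso G1 G2 v1 v2.
Proof.
move=> fG1 [_ [_ age] _ _]; pose f1 (x : void) : M1 := match x with end.
have r0 : range f1 = set0 by apply/seteqP; split=> // y [[]].
have fH : flat (pull G1 f1).
  apply/flat_onP; rewrite (rank_map_flat_on (@pull_rank_map _ _ G1 f1)) r0.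
  by move=> s _; rewrite dim_on0 ie0.
have [f2 [e2 s2]] := age void (pull G1 f1) fH.
exists void, (pull G1 f1), f1, f2, (@no_var void); split=> //.
- split; first by split=> // -[].
  rewrite r0; apply/strongP => s fs; rewrite dim_on0 ie0 dim_onT.
  exact: (ie_ge0 ((flat_familyP G1).1 fG1) fs).
- by apply/funext => -[].
- by apply/funext => -[].
Qed.

Lemma struct_of_interprets (M : choiceType) (G : pregeometry M) :
  @interprets (struct_of G) G.
Proof. by []. Qed.

(** The ultrapower shares the theory of S and is linked to G by the
    back-and-forth system, which contains the isomorphism of empty sets. *)
Theorem T_axioms_elementary (M : choiceType) (G : pregeometry M) tau (S : Lstruct) :
  generic G -> T_axioms tau S ->
  forall phi, holds S phi <-> holds (struct_of G) phi.
Proof.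
move=> hG TS phi; have [U [UU Ufree]] := free_ultrafilter.
rewrite -(@ultrapower_elementary S U UU).
have [|G1 [i1 f1 _ ext1]] := (models_T_axioms tau (ultrapower S U)).1 _.
  by move=> psi Tpsi; rewrite ultrapower_elementary; exact: Tpsi.
rewrite /holds; apply: (strong_iso_sat i1 (@struct_of_interprets M G)).
- exact: flat_strong_closures.
- exact: generic_strong_closures.
- exact: ultrapower_rich i1 f1 ext1.
- exact: generic_rich.
- exact: strong_iso_empty.
Qed.

Theorem corollary3p2p15 (M : choiceType) (G : pregeometry M)
    (tau : nat -> nat) (hG : generic G) (htau : forall n : nat, n <= tau n)
    (hsat : satisfiable (T_ tau)) :
  [/\ (forall S : Lstruct, models S (T_ tau) <-> T_axioms tau S),
      theory_equiv (T_ tau) (Th (struct_of G)),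
      complete (T_ tau) &
      forall tau' : nat -> nat, (forall n : nat, n <= tau' n) ->
        satisfiable (T_ tau') -> theory_equiv (T_ tau') (T_ tau)].
Proof.
have eqG t : satisfiable (T_ t) -> theory_equiv (T_ t) (Th (struct_of G)).
  move=> [S0 /models_T_axioms TS0] S; split=> [/models_T_axioms TS phi Gphi|h phi Tphi].
    exact/(T_axioms_elementary hG TS).
  by apply: h; apply/(T_axioms_elementary hG TS0); exact: Tphi.
split.
- exact: models_T_axioms.
- exact: eqG.
- split=> // phi; have [Gphi|nGphi] := pselect (holds (struct_of G) phi); [left|right].
    by move=> S /models_T_axioms TS; exact/(T_axioms_elementary hG TS).
  move=> S /models_T_axioms TS h.
  by apply: nGphi; exact/(T_axioms_elementary hG TS).
- by move=> t _ sat_t S; rewrite (eqG _ sat_t) (eqG _ hsat).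
Qed.
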